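(* Let $0<p<\infty$, let $w,v\in A_\infty$, and let $f$ be a complex-valued function on $\mathbb{R}^n$. Then $f$ is in $L^1_{loc}(v)$ and satisfies $$\sup_{Q\in\mathcal{Q}}\Big(\frac1{w(Q)}\int_Q|f(x)-f_{v,Q}|^p\,w(x)\,dx\Big)^{1/p}<\infty,$$ where $f_{v,Q}=\frac1{v(Q)}\int_Q f(x)v(x)\,dx$ and $w(Q)=\int_Q w(x)\,dx$, if and only if $f$ is in $BMO$. In such a case $$\|f\|_{BMO}\approx\sup_{Q\in\mathcal{Q}}\Big(\frac1{w(Q)}\int_Q|f(x)-f_{v,Q}|^p\,w(x)\,dx\Big)^{1/p},$$ with implicit constants independent of $f$.
   Context: $\mathcal{Q}$ is the collection of all cubes in $\mathbb{R}^n$ with sides parallel to the axes. $A_\infty=\bigcup_{1<p<\infty}A_p$, where $A_p$ is the usual Muckenhoupt class over cubes with respect to Lebesgue measure: non-negative locally integrable $w$ with $\sup_{Q\in\mathcal{Q}}\big(\frac1{|Q|}\int_Q w\big)\big(\frac1{|Q|}\int_Q w^{-p'/p}\big)^{p/p'}<\infty$, $p'=p/(p-1)$. $L^1_{loc}(v)$ is the set of measurable $f$ with $\int_Q|f|v\,dx<\infty$ for all $Q\in\mathcal{Q}$. $BMO$ is the set of locally integrable $f$ with $\|f\|_{BMO}=\sup_{Q\in\mathcal{Q}}\frac1{|Q|}\int_Q|f(x)-f_Q|\,dx<\infty$, $f_Q=\frac1{|Q|}\int_Qf\,dx$. $A\approx B$ means that each quantity is bounded by a constant multiple of the other. *)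

(* Defs.v *)
From HB Require Import structures.
From mathcomp Require Import all_boot all_order all_algebra.
From mathcomp Require Import all_classical all_reals all_analysis.
From mathcomp Require Export complex.

Set Implicit Arguments.
Unset Strict Implicit.
Unset Printing Implicit Defensive.

Import Order.TTheory GRing.Theory Num.Theory.

Local Open Scope classical_set_scope.
Local Open Scope ring_scope.
Local Open Scope ereal_scope.

Section lebesgue_step.
Context {R : realType} (n : nat).
Notation mR := (measurableTypeR R).

Definition cons_pair (z : mR * n.-tuple mR) : n.+1.-tuple mR :=
  [tuple of z.1 :: z.2].

Lemma measurable_cons_pair : measurable_fun [set: _] cons_pair.
Proof.
exact: (@measurable_cons _ _ _ _ fst n snd measurable_fst measurable_snd).
Qed.

Variable m : {sigma_finite_measure set (n.-tuple mR) -> \bar R}.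

Definition lebesgue_step : set (n.+1.-tuple mR) -> \bar R :=
  pushforward (lebesgue_measure \x m) cons_pair.

Let step0 : lebesgue_step set0 = 0.
Proof. by rewrite /lebesgue_step /pushforward preimage_set0 measure0. Qed.

Let step_ge0 A : 0 <= lebesgue_step A.
Proof. by rewrite /lebesgue_step /pushforward; exact: measure_ge0. Qed.

Let mpre (A : set (n.+1.-tuple mR)) : measurable A ->
  measurable (cons_pair @^-1` A).
Proof.
by move=> mA; rewrite -[X in measurable X]setTI; exact: measurable_cons_pair.
Qed.

Let step_sigma_additive : semi_sigma_additive lebesgue_step.
Proof.
move=> F mF tF mUF; rewrite /lebesgue_step /pushforward preimage_bigcup.
apply: measure_semi_sigma_additive.
- by move=> k; exact: mpre.
- apply/trivIsetP => /= i j _ _ ij; rewrite -preimage_setI.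
  by move/trivIsetP : tF => /(_ _ _ _ _ ij) ->//; rewrite preimage_set0.
- by rewrite -preimage_bigcup; exact: mpre.
Qed.

HB.instance Definition _ := isMeasure.Build _ _ _ lebesgue_step
  step0 step_ge0 step_sigma_additive.

Let uncons (x : n.+1.-tuple mR) : mR * n.-tuple mR :=
  (tnth x ord0, [tuple of behead x]).

Let unconsK : cancel cons_pair uncons.
Proof.
by case=> t x; rewrite /uncons /cons_pair; congr pair => //; exact/val_inj.
Qed.

Let measurable_uncons : measurable_fun [set: _] uncons.
Proof.
apply/measurable_fun_pairP; split => /=.
  exact: measurable_tnth.
exact: measurable_behead.
Qed.

Let step_sigma_finite : sigma_finite setT lebesgue_step.
Proof.
have /sigma_finiteP[F [TF ndF Foo]] := sigma_finiteT (@lebesgue_measure R).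
have /sigma_finiteP[G [TG ndG Goo]] := sigma_finiteT m.
exists (fun k => uncons @^-1` (F k `*` G k)).
  rewrite -preimage_bigcup (_ : \bigcup_k _ = setT) ?preimage_setT//.
  apply/seteqP; split => // -[t x] _.
  have [i _ Fit] : (\bigcup_k F k) t by rewrite -TF.
  have [j _ Gjx] : (\bigcup_k G k) x by rewrite -TG.
  exists (maxn i j) => //; split => /=.
  - by move: t Fit; exact/subsetPset/ndF/leq_maxl.
  - by move: x Gjx; exact/subsetPset/ndG/leq_maxr.
move=> k; have [mFk Fkoo] := Foo k; have [mGk Gkoo] := Goo k; split.
  rewrite -[X in measurable X]setTI; apply: measurable_uncons => //.
  exact: measurableX.
rewrite /lebesgue_step /pushforward -comp_preimage.
rewrite (_ : uncons \o cons_pair = id); last first.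
  by rewrite funeqE => z; exact: unconsK.
by rewrite preimage_id product_measure1E// lte_mul_pinfty// ge0_fin_numE.
Qed.

HB.instance Definition _ := Measure_isSigmaFinite.Build _ _ _ lebesgue_step
  step_sigma_finite.

End lebesgue_step.

(* n-fold product of the Lebesgue measure of the line, on the product
   sigma-algebra of R^n (the Borel sets) *)
Fixpoint borel_lebesgue (R : realType) (n : nat) :
    {sigma_finite_measure set (n.-tuple (measurableTypeR R)) -> \bar R} :=
  match n with
  | 0 => \d_([tuple] : 0.-tuple (measurableTypeR R))
  | k.+1 => lebesgue_step (borel_lebesgue R k)
  end.

(* R^n with the sigma-algebra of Lebesgue measurable sets, i.e. the
   Caratheodory-measurable sets of the outer measure induced by
   borel_lebesgue; it is convertible to n.-tuple R *)
Definition Rn (R : realType) (n : nat) : Type :=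
  caratheodory_type (mu_ext (borel_lebesgue R n)).

HB.instance Definition _ (R : realType) (n : nat) := Measurable.copy (Rn R n)
  (caratheodory_type (mu_ext (borel_lebesgue R n))).

Definition lebesgue (R : realType) (n : nat) : set (Rn R n) -> \bar R :=
  @completed_measure_extension _ _ _ (borel_lebesgue R n).
HB.instance Definition _ (R : realType) (n : nat) :=
  Measure.on (@lebesgue R n).

Lemma borel_lebesgue_box (R : realType) (n : nat) (a b : 'I_n -> R) :
  (forall i, (a i <= b i)%R) ->
  let B := [set x : n.-tuple (measurableTypeR R) |
              forall i, (a i <= tnth x i <= b i)%R] in
  measurable B /\ borel_lebesgue R n B = (\prod_(i < n) (b i - a i)%R)%:E.
Proof.
elim: n a b => [|n IHn] a b ab B.
  have -> : B = setT by apply/seteqP; split => // x _ [].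
  by split; [exact: measurableT|rewrite big_ord0 /= diracT].
have [mB' B'E] := IHn (a \o lift ord0) (b \o lift ord0)
  (fun i => ab (lift ord0 i)).
set B' := (X in measurable X) in mB' B'E.
have BE : cons_pair (n := n) @^-1` B = `[a ord0, b ord0]%classic `*` B'.
  apply/seteqP; split => [[t x] /= Btx|[t x] [/= tI xB'] i].
    split => [|i /=]; first by have := Btx ord0; rewrite in_itv/= tnth0.
    by have := Btx (lift ord0 i); rewrite tnthS.
  have [j ->|->] := unliftP ord0 i; first by rewrite tnthS; exact: xB'.
  by rewrite tnth0; move: tI; rewrite in_itv.
split.
  rewrite (_ : B = \bigcap_(i in [set: 'I_n.+1])
      ((fun x => tnth x i) @^-1` `[a i, b i]%classic)); last first.
    apply/seteqP; split => x Bx i => [_|]; first by rewrite /= in_itv; exact: Bx.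
    by have := Bx i Logic.I; rewrite /= in_itv.
  apply: fin_bigcap_measurable => // i _; rewrite -[X in measurable X]setTI.
  by apply: measurable_tnth => //; exact: measurable_itv.
rewrite /= /lebesgue_step /pushforward BE.
rewrite product_measure1E; [|exact: measurable_itv|exact: mB'].
rewrite B'E /= lebesgue_measure_itv/= lte_fin big_ord_recl EFinM.
case: ltP => [//|ba].
have -> : b ord0 = a ord0 by apply/eqP; rewrite eq_le ba ab.
by rewrite subrr !mul0e.
Qed.

Lemma lebesgue_box (R : realType) (n : nat) (a b : 'I_n -> R) :
  (forall i, (a i <= b i)%R) ->
  let B := [set x : Rn R n | forall i, (a i <= tnth x i <= b i)%R] in
  measurable B /\ lebesgue B = (\prod_(i < n) (b i - a i)%R)%:E.
Proof.
move=> ab B; have [mB BE] := borel_lebesgue_box ab.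
split; first exact: caratheodory_measurable_mu_ext mB.
by rewrite -BE /lebesgue /completed_measure_extension measurable_mu_extE.
Qed.

Local Close Scope ereal_scope.

Section weights_bmo.
Context {R : realType} {n : nat}.
Implicit Types (Q : set (Rn R n)) (w v : Rn R n -> R) (f : Rn R n -> R[i]).
Local Notation mu := (@lebesgue R n).
Local Notation normc := ComplexField.Normc.normc.

Definition cubes : set (set (Rn R n)) :=
  [set Q | exists (a : 'I_n -> R) (l : R), 0 < l /\
     Q = [set x : Rn R n | forall i, a i <= tnth x i <= a i + l]].

Definition vol Q : R := fine (mu Q).

(* x^(-s) for 0 <= x and 0 < s, with 0^(-s) = +oo (whereas powR 0 (- s) = 0) *)
Definition powRNy (x s : R) : \bar R :=
  if x == 0 then +oo%E else ((x `^ (- s))%:E).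

Definition conj_exp (p : R) : R := p / (p - 1).

(* The function 0 satisfies the inequality with the convention 0 * +oo = 0 of
   \bar R, hence the explicit requirement that w be not a.e. zero.  Together
   with the inequality it forces w > 0 a.e., so that 0 < w(Q) for all Q. *)
Definition Ap (p : R) : set (Rn R n -> R) := [set w : Rn R n -> R |
  [/\ measurable_fun setT w,
      (forall x, 0 <= w x),
      (forall Q, cubes Q -> (\int[mu]_(x in Q) (w x)%:E < +oo)%E),
      ~ {ae mu, forall x, w x = 0} &
      (ereal_sup [set (((vol Q)^-1)%:E * \int[mu]_(x in Q) (w x)%:E) *
                      (((vol Q)^-1)%:E *
                       \int[mu]_(x in Q) powRNy (w x) (conj_exp p / p))
                      `^ (p / conj_exp p) | Q in cubes] < +oo)%E]].

Definition Ainfty : set (Rn R n -> R) :=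
  \bigcup_(p in [set p : R | 1 < p]) Ap p.

Definition cmeasurable f :=
  measurable_fun setT (fun x => complex.Re (f x)) /\
  measurable_fun setT (fun x => complex.Im (f x)).

Definition L1loc v : set (Rn R n -> R[i]) := [set f : Rn R n -> R[i] | cmeasurable f /\
  forall Q, cubes Q -> (\int[mu]_(x in Q) (normc (f x) * v x)%:E < +oo)%E].

Definition cintegral Q f : R[i] :=
  Complex (\int[mu]_(x in Q) complex.Re (f x)) (\int[mu]_(x in Q) complex.Im (f x)).

Definition weight w Q : R := \int[mu]_(x in Q) w x.

Definition mean f Q : R[i] := ((vol Q)^-1)%:C%C * cintegral Q f.

Definition wmean v f Q : R[i] :=
  ((weight v Q)^-1)%:C%C * cintegral Q (fun x => f x * (v x)%:C%C).

Definition BMO_norm f : \bar R :=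
  ereal_sup [set (((vol Q)^-1)%:E *
    \int[mu]_(x in Q) (normc (f x - mean f Q))%:E)%E | Q in cubes].

Definition BMO : set (Rn R n -> R[i]) := [set f : Rn R n -> R[i] |
  L1loc (cst 1) f /\ (BMO_norm f < +oo)%E].

Definition weighted_osc (p : R) w v f : \bar R :=
  ereal_sup [set ((((weight w Q)^-1)%:E *
    \int[mu]_(x in Q) (normc (f x - wmean v f Q) `^ p * w x)%:E) `^ p^-1)%E
    | Q in cubes].

End weights_bmo.

(* Main.v *)
From HB Require Import structures.
Require Import Defs.
From mathcomp Require Import all_boot all_order all_algebra.
From mathcomp Require Import all_classical all_reals all_analysis.
From mathcomp Require Import measurable_realfun ring lra.

Set Implicit Arguments.
Unset Strict Implicit.
Unset Printing Implicit Defensive.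

Import Order.TTheory GRing.Theory Num.Theory.
Import numFieldNormedType.Exports.

Local Open Scope classical_set_scope.
Local Open Scope ring_scope.

(** The theorem rests on a weak form of mean oscillation.  Fix a choice of
    centres c_Q and s > 0, and suppose that on every cube Q the inequality
    |f - c_Q| > s holds on at most the fraction 2^-(n+2) of Q ([osc_small]).
    Both sides of the equivalence give this by Chebyshev's inequality: a
    function of BMO with c_Q = f_Q and s comparable to its norm
    ([BMO_osc_small]); a function with finite weighted oscillation with
    c_Q = f_{v,Q} and s comparable to that oscillation
    ([weighted_osc_osc_small]), because a weight of A_infty cannot give a small
    part of its mass to a fixed fraction of a cube
    ([Ainfty_regular_weight]).

    Conversely, this smallness improves itself, in the manner of John,
    Nirenberg and Stroemberg.  In a cube Q, stop at the maximal dyadic subcubes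
    Q' of which E = {|f - c_Q| > s} fills more than the fraction 2^-(n+1).
    Almost all of E lies in them, and they fill at most half of Q, hence at
    most the fraction beta < 1 of its mass for a weight u of A_infty.  The
    parent of Q' was not stopped, so E fills at most half of Q'; some point of
    Q' then has |f - c_Q| <= s and |f - c_{Q'}| <= s, which gives
    |c_Q - c_{Q'}| <= 2s.  By induction the u-mass of {|f - c_Q| > (2k+1)s} in
    Q is at most beta^k u(Q) ([osc_decay]), and integration yields a bound
    C s^r u(Q) for the u-integral of |f - c_Q|^r over Q, for every r > 0
    ([osc_small_integral]).

    Taking r = 1 shows that the centres may be replaced by the u-means, at the
    price of a larger s ([osc_small_wmean]).  With u = v one passes from f_Q to
    f_{v,Q} and integrates against w; with u = 1 one passes from f_{v,Q} to f_Q
    and integrates against Lebesgue measure.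

    The role usually played by Lebesgue's differentiation theorem, namely that
    almost all of E lies in the stopped cubes, is taken by the approximation of
    measurable sets by finite unions of dyadic cubes of one generation
    ([dapprox_measurable]): the unstopped cubes of an approximation of E are
    both nearly filled by E and filled at most to the fraction 2^-(n+1), so
    their total measure is small. *)

(** * Cubes and their dyadic children *)

Lemma fsbig_finT (R : realType) (I : finType) (F : I -> \bar R) :
  (\sum_(i \in [set: I]) F i = \sum_i F i)%E.
Proof.
rewrite (fsbigE (index_enum I)) ?index_enum_uniq//.
  by apply: eq_bigl => i; rewrite in_setT.
by move=> i _; rewrite mem_index_enum.
Qed.

Lemma subset_le_measure d (T : measurableType d) (R : realType)
    (m : {measure set T -> \bar R}) (A B : set T) :
  measurable A -> measurable B -> A `<=` B -> (m A <= m B)%E.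
Proof. by move=> mA mB AB; rewrite le_measure ?inE. Qed.

Section geometry.
Context {R : realType} {n : nat}.
Local Notation T := (Rn R n).
Local Notation mu := (@lebesgue R n).
Implicit Types (a : 'I_n -> R) (l : R) (e : {ffun 'I_n -> bool}).

Definition closed_cube a l : set T :=
  [set x : T | forall i, a i <= tnth x i <= a i + l].

(** Cubes are taken half-open here, so that the dyadic children form a genuine
    partition; the faces that are lost have measure zero. *)
Definition dcube a l : set T :=
  [set x : T | forall i, a i <= tnth x i < a i + l].

Definition corner a l e : 'I_n -> R := fun i => a i + (e i)%:R * (l / 2).

Definition dchild a l e : set T := dcube (corner a l e) (l / 2).

Lemma measurable_borel (A : set (n.-tuple (measurableTypeR R))) :
  measurable A -> measurable (A : set T).
Proof. exact: caratheodory_measurable_mu_ext. Qed.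

Lemma measurable_coord (i : 'I_n) (B : set (measurableTypeR R)) :
  measurable B -> measurable ([set x | B (tnth x i)] : set T).
Proof.
move=> mB; apply: measurable_borel.
have := @measurable_tnth _ (measurableTypeR R) n i measurableT _ mB.
by rewrite setTI.
Qed.

Lemma measurable_closed_cube a l : 0 <= l -> measurable (closed_cube a l).
Proof.
by move=> l0; have [] := @lebesgue_box R n a (fun i => a i + l)
  (fun i => ltac:(by rewrite lerDl)).
Qed.

Lemma measurable_dcube a l : measurable (dcube a l).
Proof.
rewrite (_ : dcube a l = \bigcap_(i in [set: 'I_n])
    [set x | `[a i, a i + l[%classic (tnth x i)]); last first.
  apply/seteqP; split => x xP i => [_|]; first by rewrite /= in_itv; exact: xP.
  by have := xP i Logic.I; rewrite /= in_itv.
apply: fin_bigcap_measurable => // i _; apply: measurable_coord.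
exact: measurable_itv.
Qed.

Lemma lebesgue_closed_cube a l : 0 <= l -> mu (closed_cube a l) = (l ^+ n)%:E.
Proof.
move=> l0; have [_] := @lebesgue_box R n a (fun i => a i + l)
  (fun i => ltac:(by rewrite lerDl)).
rewrite -/(closed_cube a l) => ->; congr EFin.
under eq_bigr do rewrite addrAC subrr add0r.
by rewrite prodr_const card_ord.
Qed.

Lemma dcube_sub_closed a l : dcube a l `<=` closed_cube a l.
Proof. by move=> x xP i; have /andP[-> /ltW ->] := xP i. Qed.

Lemma lebesgue_closed_cubeD a l : 0 < l ->
  mu (closed_cube a l `\` dcube a l) = 0%E.
Proof.
move=> l0; pose F i := [set x : T | forall j, (if j == i then a j + l else a j)
  <= tnth x j <= a j + l].
have FE i : measurable (F i) /\ mu (F i) = 0%E.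
  have [|mF ->] := @lebesgue_box R n (fun j => if j == i then a j + l else a j)
    (fun i => a i + l).
    by move=> j; case: ifP => // _; rewrite lerDl ltW.
  by split => //; rewrite (bigD1 i)//= eqxx subrr mul0r.
apply: (@subset_measure0 _ _ _ _ _ (\bigcup_(i in [set: 'I_n]) F i)).
- by apply: measurableD; [exact/measurable_closed_cube/ltW|
    exact: measurable_dcube].
- by apply: fin_bigcup_measurable => // i _; have [] := FE i.
- move=> x [xc /existsNP[i xi]]; exists i => // j.
  have /andP[aj jl] := xc j; rewrite jl andbT; case: eqVneq => // ji.
  by rewrite leNgt; apply/negP => xl; apply: xi; rewrite -ji aj xl.
- apply/eqP; rewrite eq_le measure_ge0 andbT.
  apply: le_trans (_ : (\sum_(i \in [set: 'I_n]) mu (F i) <= 0)%E).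
    apply: content_sub_fsum; [exact: finite_finset| | |by []].
      by move=> i _; have [] := FE i.
    by apply: fin_bigcup_measurable => // i _; have [] := FE i.
  by rewrite fsbig_finT big1// => i _; have [] := FE i.
Qed.

Lemma lebesgue_dcube a l : 0 < l -> mu (dcube a l) = (l ^+ n)%:E.
Proof.
move=> l0; rewrite -(@lebesgue_closed_cube a l) ?ltW//.
rewrite [RHS](@measureDI _ _ _ mu (closed_cube a l) (dcube a l)).
- rewrite [X in (X + _)%E]lebesgue_closed_cubeD// add0e.
  by rewrite setIC (setIidl (@dcube_sub_closed a l)).
- exact/measurable_closed_cube/ltW.
- exact: measurable_dcube.
Qed.

(** The child that contains a point is read off by comparing each coordinate with
    the midpoint of the corresponding side. *)
Lemma dchild_half a l e x : 0 < l -> dchild a l e x <->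
  dcube a l x /\ forall i, e i = (a i + l / 2 <= tnth x i).
Proof.
move=> l0; rewrite /dchild /dcube /corner; split => [xe|[xP ex] i].
  split => i; have := xe i; case: (e i);
    rewrite /= ?mulr1n ?mulr0n ?(mul0r, mul1r, addr0) => /andP[h1 h2].
  - by apply/andP; split; lra.
  - by apply/andP; split; lra.
  - by rewrite h1.
  - by rewrite leNgt h2.
have := xP i; move=> /andP[ax xl]; rewrite ex.
by case: (leP (a i + l / 2) (tnth x i)) => h;
  rewrite /= ?mulr1n ?mulr0n ?(mul0r, mul1r, addr0);
  apply/andP; split; lra.
Qed.

Lemma dchild_sub a l e : 0 < l -> dchild a l e `<=` dcube a l.
Proof. by move=> l0 x /(dchild_half _ _ _ l0)[]. Qed.

Lemma bigcup_dchild a l : 0 < l ->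
  dcube a l = \bigcup_(e in [set: {ffun 'I_n -> bool}]) dchild a l e.
Proof.
move=> l0; apply/seteqP; split => [x xP|x [e _ /dchild_sub]]; last exact.
exists [ffun i => a i + l / 2 <= tnth x i] => //.
by apply/dchild_half => //; split => // i; rewrite ffunE.
Qed.

Lemma trivIset_dchild a l : 0 < l ->
  trivIset [set: {ffun 'I_n -> bool}] (dchild a l).
Proof.
move=> l0 e e' _ _ [x [/(dchild_half _ _ _ l0)[_ h]
  /(dchild_half _ _ _ l0)[_ h']]].
by apply/ffunP => i; rewrite h h'.
Qed.

Lemma measure_dchild (m : {measure set T -> \bar R}) (A : set T) a l :
  0 < l -> measurable A ->
  (m (A `&` dcube a l) = \sum_(e : {ffun 'I_n -> bool}) m (A `&` dchild a l e))%E.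
Proof.
move=> l0 mA; rewrite (bigcup_dchild a l0) setI_bigcupr.
rewrite measure_fin_bigcup//; first by rewrite fsbig_finT.
- exact: finite_finset.
- exact/trivIset_setIl/trivIset_dchild.
- by move=> e _; apply: measurableI => //; exact: measurable_dcube.
Qed.

Lemma lebesgue_dchild a l e : 0 < l ->
  mu (dcube a l) = ((2 ^+ n)%:E * mu (dchild a l e))%E.
Proof.
move=> l0; rewrite !lebesgue_dcube ?divr_gt0//.
by rewrite -EFinM -exprMn mulrC divfK// pnatr_eq0.
Qed.

End geometry.

(** * Approximation by unions of dyadic cubes *)

Section approximation.
Context {R : realType} {n : nat}.
Local Notation T := (Rn R n).
Local Notation mu := (@lebesgue R n).
Implicit Types (a : 'I_n -> R) (l : R) (e : {ffun 'I_n -> bool}) (A B D : set T).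

(** Within the cube of corner [a] and side [l], the set [D] is a union of dyadic
    subcubes of generation [k].  What [D] does outside the cube is left free,
    which makes this property stable under complement and union. *)
Fixpoint dset k a l D : Prop :=
  if k is k'.+1 then forall e, dset k' (corner a l e) (l / 2) D
  else dcube a l `<=` D \/ dcube a l `<=` ~` D.

Lemma dsetC k a l D : dset k a l D -> dset k a l (~` D).
Proof.
elim: k a l => [|k IH] a l /= => [[h|h]|h e]; last exact/IH.
  by right; rewrite setCK.
by left.
Qed.

Lemma dsetU k a l D D' : dset k a l D -> dset k a l D' -> dset k a l (D `|` D').
Proof.
elim: k a l => [|k IH] a l /= => [[h|h] [h'|h']|h h' e]; last exact/IH.
- by left => x /h; left.
- by left => x /h; left.
- by left => x /h'; right.
- by right => x xP [/(h x xP)|/(h' x xP)].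
Qed.

Lemma dsetS k a l D : 0 < l -> dset k a l D -> dset k.+1 a l D.
Proof.
elim: k a l => [|k IH] a l l0 /=.
  by move=> [h|h] e; [left|right]; apply: subset_trans h; exact: dchild_sub.
by move=> h e; apply: IH => //; rewrite divr_gt0.
Qed.

Lemma dset_leq k k' a l D : 0 < l -> (k <= k')%N -> dset k a l D -> dset k' a l D.
Proof.
move=> l0 /subnK <-; elim: (k' - k)%N => // j IH /IH.
by rewrite addSn; exact: dsetS.
Qed.

(** The integer [m] is arbitrary so that the induction can pass to a child, in
    which the same hyperplane has another dyadic address. *)
Lemma dset_halfspace k a l (i : 'I_n) (m : int) : 0 < l ->
  dset k a l [set x : T | tnth x i < a i + m%:~R * (l / 2 ^+ k)].
Proof.
elim: k a l m => [|k IH] a l m l0.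
  rewrite expr0 divr1; have [m0|m0] := leP m 0.
    right => x xP /=; have /andP[ax _] := xP i; apply/negP; rewrite -leNgt.
    apply: le_trans ax; rewrite gerDl mulr_le0_ge0 ?lerz0// ltW//.
  left => x xP /=; have /andP[_ xl] := xP i; apply: lt_le_trans xl _.
  by rewrite lerD2l ler_peMl ?(ltW l0)// ler1z -gtz0_ge1.
move=> e /=.
have -> : a i + m%:~R * (l / 2 ^+ k.+1) = corner a l e i +
    (m - (e i)%:Z * (2 ^ k)%N%:Z)%:~R * (l / 2 / 2 ^+ k).
  rewrite /corner rmorphB rmorphM/= exprS.
  rewrite -!pmulrn natrX.
  have : (2 : R) ^+ k != 0 by rewrite expf_neq0// pnatr_eq0.
  by move=> h; field.
by apply: IH; rewrite divr_gt0.
Qed.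

(** The sets with this property form a sigma-algebra that contains the half-spaces,
    hence the Borel sets. *)
Definition dapprox a l (A : set T) := forall eps : R, 0 < eps ->
  exists k D, [/\ measurable D, dset k a l D &
    (mu (dcube a l `&` ((A `\` D) `|` (D `\` A))) <= eps%:E)%E].

Lemma dapproxC a l A : dapprox a l A -> dapprox a l (~` A).
Proof.
move=> hA eps /hA[k [D [mD dD AD]]]; exists k, (~` D); split.
- exact: measurableC.
- exact: dsetC.
- suff -> : (~` A `\` ~` D) `|` (~` D `\` ~` A) = (A `\` D) `|` (D `\` A) by [].
  by rewrite !setDE !setCK setUC; congr setU; exact: setIC.
Qed.

Lemma dapprox_triangle a l A : measurable A ->
  (forall eps : R, 0 < eps -> exists A' : set T, [/\ measurable A', dapprox a l A' &
    (mu (dcube a l `&` ((A `\` A') `|` (A' `\` A))) <= eps%:E)%E]) ->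
  dapprox a l A.
Proof.
move=> mA h eps e0; have e20 : 0 < eps / 2 by rewrite divr_gt0.
have [A' [mA' hA' AA']] := h _ e20.
have [k [D [mD dD A'D]]] := hA' _ e20; exists k, D; split => //.
rewrite [eps]splitr EFinD; apply: le_trans (leeD AA' A'D).
have mS (X Y : set T) : measurable X -> measurable Y ->
    measurable (dcube a l `&` ((X `\` Y) `|` (Y `\` X))).
  move=> mX mY; apply: measurableI; first exact: measurable_dcube.
  by apply: measurableU; exact: measurableD.
apply: le_trans (measureU2 _ _ _); [|exact: mS|exact: mS].
apply: subset_le_measure; [exact: mS|by apply: measurableU; exact: mS|].
move=> x [xP [[Ax nDx]|[Dx nAx]]].
- by have [A'x|nA'x] := pselect (A' x); [right|left]; split => //; left.
- by have [A'x|nA'x] := pselect (A' x); [left|right]; split => //; right.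
Qed.

Let mS a l (X Y : set T) : measurable X -> measurable Y ->
  measurable (dcube a l `&` ((X `\` Y) `|` (Y `\` X))).
Proof.
move=> mX mY; apply: measurableI; first exact: measurable_dcube.
by apply: measurableU; exact: measurableD.
Qed.

Lemma dapprox_dset k a l D : measurable D -> dset k a l D -> dapprox a l D.
Proof.
move=> mD dD eps e0; exists k, D; split => //.
by rewrite !setDv setU0 setI0 measure0 lee_fin ltW.
Qed.

Lemma dapproxU a l A B : 0 < l -> measurable A -> measurable B ->
  dapprox a l A -> dapprox a l B -> dapprox a l (A `|` B).
Proof.
move=> l0 mA mB hA hB eps e0; have e20 : 0 < eps / 2 by rewrite divr_gt0.
have [k [D [mD dD AD]]] := hA _ e20; have [k' [D' [mD' dD' AD']]] := hB _ e20.
exists (maxn k k'), (D `|` D'); split; first exact: measurableU.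
  by apply: dsetU; [apply: dset_leq dD|apply: dset_leq dD'];
    rewrite // (leq_maxl, leq_maxr).
rewrite [eps]splitr EFinD; apply: le_trans (leeD AD AD').
apply: le_trans (measureU2 _ _ _); [|exact: mS|exact: mS].
apply: subset_le_measure.
- by apply: mS; exact: measurableU.
- by apply: measurableU; exact: mS.
- move=> x [xP [[[Ax|Bx] nDx]|[[Dx|Dx] nAx]]].
  + by left; split => //; left; split => // Dx; apply: nDx; left.
  + by right; split => //; left; split => // Dx; apply: nDx; right.
  + by left; split => //; right; split => // Ax; apply: nAx; left.
  + by right; split => //; right; split => // Ax; apply: nAx; right.
Qed.

(** Up to small measure in the cube, a countable union is a finite one, by
    continuity from above of the measure. *)
Lemma dapprox_bigcup a l (A : (set T)^nat) : 0 < l ->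
  (forall j, measurable (A j)) -> (forall j, dapprox a l (A j)) ->
  dapprox a l (\bigcup_j A j).
Proof.
move=> l0 mA hA; set B := \bigcup_j A j.
have mB : measurable B by exact: bigcupT_measurable.
pose S J := \big[setU/set0]_(j < J) A j.
have mSJ J : measurable (S J) by exact: bigsetU_measurable.
apply: dapprox_triangle => // eps e0.
have hS J : dapprox a l (S J).
  elim: J => [|J IH]; rewrite /S ?big_ord0 ?big_ord_recr /=.
    by apply: (@dapprox_dset 0%N) => //=; right => x _ [].
  by exact: (dapproxU l0 (mSJ J) (mA J) IH (hA J)).
pose F J := dcube a l `&` (B `\` S J).
have mF J : measurable (F J).
  by apply: measurableI; [exact: measurable_dcube|exact: measurableD].
have F0 : \bigcap_J F J = set0.
  apply/seteqP; split => // x xF; have [_ [[j _ Ajx] _]] := xF 0%N Logic.I.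
  have [_ [_]] := xF j.+1 Logic.I; apply.
  by rewrite /S big_ord_recr/=; right.
have := @nonincreasing_cvg_mu _ _ _ mu F.
rewrite F0 measure0 => /(_ _ mF measurable0).
have -> : (mu (F 0%N) < +oo)%E.
  apply: le_lt_trans (_ : (mu (dcube a l) < +oo)%E).
    by apply: measureIl => //; [exact: measurable_dcube|exact: measurableD].
  by rewrite lebesgue_dcube// ltry.
have ndF : nonincreasing_seq F.
  move=> i j ij; apply/subsetPset => x [xP [Bx nS]]; split => //; split => // Sx.
  apply: nS; move: x Sx {xP Bx}; exact: subset_bigsetU.
move=> /(_ isT ndF) muF.
have [J FJ] : exists J, (mu (F J) <= eps%:E)%E.
  apply: contrapT => /forallNP h.
  have : (eps%:E <= limn (mu \o F))%E.
    apply: lime_ge; first by apply/cvg_ex; exists 0%E.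
    by apply: nearW => J; rewrite /= leNgt; apply/negP => /ltW/h.
  by rewrite (cvg_lim _ muF)// leNgt lte_fin e0.
exists (S J); split => //; apply: le_trans FJ.
apply: subset_le_measure; [exact: mS|exact: mF|].
move=> x [xP [[Bx nSx]|[Sx nBx]]]; first by split.
by exfalso; apply: nBx; move: Sx; rewrite /S -bigcup_mkord => -[j _ ?]; exists j.
Qed.

(** The integers [m k] give the largest dyadic thresholds not exceeding [c]; the
    half-space is the union of the half-spaces that these define. *)
Lemma dapprox_halfspace a l (i : 'I_n) (c : R) : 0 < l ->
  dapprox a l [set x : T | tnth x i < c].
Proof.
move=> l0.
pose m (k : nat) := Num.floor ((c - a i) * 2 ^+ k / l).
pose D k := [set x : T | tnth x i < a i + (m k)%:~R * (l / 2 ^+ k)].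
have p2 k : (0 : R) < 2 ^+ k by rewrite exprn_gt0.
have -> : [set x : T | tnth x i < c] = \bigcup_k D k.
  apply/seteqP; split => [x /= xc|x [k _]]; last first.
    rewrite /D/= => /lt_le_trans; apply; rewrite -lerBrDl.
    have h : (m k)%:~R <= (c - a i) * 2 ^+ k / l by exact: ge_floor.
    by move: h; rewrite ler_pdivlMr// mulrA ler_pdivrMr.
  have [k hk] : exists k, l / (c - tnth x i) < 2 ^+ k.
    exists (Num.truncn (l / (c - tnth x i))).+1.
    apply: lt_trans (truncnS_gt _) _.
    by rewrite -natrX ltr_nat ltn_expl.
  exists k => //; rewrite /D/=.
  have := floorD1_gt ((c - a i) * 2 ^+ k / l); rewrite -/(m k) intrD => h.
  move: hk; rewrite ltr_pdivrMr ?subr_gt0// => hk.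
  rewrite -ltrBlDl mulrA ltr_pdivlMr//.
  by move: h; rewrite ltr_pdivrMr// => h; lra.
apply: dapprox_bigcup => // k; last first.
  apply: (@dapprox_dset k); last exact: dset_halfspace.
  by apply: (measurable_coord i (measurable_itv `]-oo, _[)).
by apply: (measurable_coord i (measurable_itv `]-oo, _[)).
Qed.

End approximation.

Section approximation_lebesgue.
Context {R : realType} {n : nat}.
Local Notation T := (Rn R n).
Local Notation mu := (@lebesgue R n).
Implicit Types (a : 'I_n -> R) (l : R) (A B : set T).

Lemma sigma_algebra_dapprox a l : 0 < l ->
  sigma_algebra [set: T] [set A | measurable A /\ dapprox a l A].
Proof.
move=> l0; split.
- split; first exact: measurable0.
  by apply: (@dapprox_dset _ _ 0%N) => //=; right => x _ [].
- by move=> A [mA hA]; rewrite setTD; split; [exact: measurableC|exact: dapproxC].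
- move=> A hA; split; first by apply: bigcupT_measurable => i; have [] := hA i.
  by apply: dapprox_bigcup => // j; have [] := hA j.
Qed.

Lemma dapprox_borel a l (A : set (n.-tuple (measurableTypeR R))) : 0 < l ->
  measurable A -> dapprox a l (A : set T).
Proof.
move=> l0; have sG := sigma_algebra_dapprox a l0.
suff: (measurable : set (set (n.-tuple (measurableTypeR R)))) `<=`
    [set A : set T | measurable A /\ dapprox a l A] by move=> h /h[].
apply: smallest_sub => // B; case: n a sG B => [|n'] a sG B.
  by rewrite big_ord0.
rewrite -bigcup_mkord_ord => -[k kn [C mC <-]]; rewrite setTI.
set i := inord k.
have sB : sigma_algebra setT [set D : set R | measurable
    ([set x | D (tnth x i)] : set (Rn R n'.+1)) /\
    dapprox a l [set x : Rn R n'.+1 | D (tnth x i)]].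
  have [s0 sC sU] := sG; split => // [D hD|D hD].
  - by have := sC _ hD; rewrite !setTD.
  - by have := sU _ hD; rewrite -preimage_bigcup.
suff: (measurable : set (set (measurableTypeR R))) `<=` [set D : set R | measurable
    ([set x | D (tnth x i)] : set (Rn R n'.+1)) /\
    dapprox a l [set x : Rn R n'.+1 | D (tnth x i)]] by move=> /(_ _ mC)[].
rewrite RGenCInfty.measurableE; apply: smallest_sub => // _ [c ->] /=.
have -> : [set x : Rn R n'.+1 | `[c, +oo[%classic (tnth x i)] =
    ~` [set x : Rn R n'.+1 | tnth x i < c].
  by apply/seteqP; split => x /=; rewrite in_itv/= andbT leNgt => /negP.
split; last exact/dapproxC/dapprox_halfspace.
apply: measurableC.
exact: (measurable_coord i (measurable_itv `]-oo, _[)).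
Qed.

(** By definition of the outer measure, a Lebesgue measurable set differs by a set of
    small measure, inside the cube, from a countable union of Borel sets that
    covers it. *)
Lemma dapprox_measurable a l (A : set T) : 0 < l ->
  measurable A -> dapprox a l A.
Proof.
move=> l0 mA; apply: dapprox_triangle => // eps e0.
pose E := A `&` dcube a l.
have mE : measurable E by apply: measurableI => //; exact: measurable_dcube.
have muEoo : (mu E < +oo)%E.
  apply: le_lt_trans (_ : (mu (dcube a l) < +oo)%E).
    by apply: measureIr => //; exact: measurable_dcube.
  by rewrite lebesgue_dcube// ltry.
have Efin : mu E \is a fin_num by rewrite ge0_fin_numE.
have [_ [F [mF EF] <-] FE] := lb_ereal_inf_adherent e0 Efin.
pose B : set (n.-tuple (measurableTypeR R)) := \bigcup_k F k.
have mB : measurable B by exact: bigcupT_measurable.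
have mB' : measurable (B : set T) := measurable_borel mB.
exists (B : set T); split => //; first exact: dapprox_borel.
have muB : (mu (B : set T) <= mu E + eps%:E)%E.
  apply: le_trans (ltW FE).
  rewrite /lebesgue /completed_measure_extension measurable_mu_extE//.
  by apply: measure_sigma_subadditive.
apply: le_trans (_ : mu ((B : set T) `\` E) <= _)%E.
  apply: subset_le_measure.
  - apply: measurableI; first exact: measurable_dcube.
    by apply: measurableU; exact: measurableD.
  - exact: measurableD.
  - move=> x [xP [[Ax nBx]|[Bx nAx]]].
      by exfalso; apply: nBx; apply: EF.
    by split => // -[].
rewrite measureD//; last by rewrite (le_lt_trans muB)// lte_add_pinfty// ltry.
rewrite (_ : _ `&` E = E); last first.
  by apply/seteqP; split => [x []//|x Ex]; split => //; exact: EF.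
by rewrite leeBlDr// addeC.
Qed.

End approximation_lebesgue.

(** * The stopping-cube argument *)

Section stopping.
Context {R : realType} {n : nat}.
Local Notation T := (Rn R n).
Local Notation mu := (@lebesgue R n).
Implicit Types (a : 'I_n -> R) (l : R).
Variables (E G : set T) (nu : {measure set T -> \bar R}) (theta kappa : \bar R).
Hypotheses (mE : measurable E) (mG : measurable G).
Hypotheses (theta0 : (0 <= theta)%E) (kappa0 : (0 <= kappa)%E).
Hypothesis EG : forall a l, 0 < l ->
  (mu (E `&` dcube a l) <= (2 ^+ n)%:E * (theta * mu (dcube a l)))%E ->
  (nu (G `&` dcube a l) <= kappa * nu (dcube a l))%E.

(** [N] plays the role of the union of the stopped cubes of generation at most
    [k].  The last clause says that the remaining cubes of generation [k] are
    filled by [E] at most to the fraction [theta]. *)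
Let stop k a l (N : set T) := [/\ measurable N,
  (theta * mu (N `&` dcube a l) <= mu (E `&` N `&` dcube a l))%E,
  (nu (G `&` N `&` dcube a l) <= kappa * nu (N `&` dcube a l))%E &
  forall D : set T, measurable D -> dset k a l D ->
  (mu (E `&` (D `\` N) `&` dcube a l) <= theta * mu ((D `\` N) `&` dcube a l))%E].

(** A child that [E] fills to more than the fraction [theta] is taken whole into
    [N]; since its parent is filled at most to the fraction [theta], the child is
    filled at most to the fraction [2^n theta], which is what [EG] requires.  In
    the other children the argument is repeated. *)
Lemma calderon_zygmund k a l : 0 < l ->
  (mu (E `&` dcube a l) <= theta * mu (dcube a l))%E ->
  exists N, stop k a l N.
Proof.
elim: k a l => [|k IH] a l l0 Ea.
  exists set0; split; rewrite ?setI0 ?set0I ?measure0 ?mule0//.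
  move=> D mD; rewrite setD0 => -[h|h].
    rewrite (_ : E `&` D `&` dcube a l = E `&` dcube a l); last first.
      by rewrite -setIA (setIidr h).
    by rewrite (setIidr h).
  have D0 : D `&` dcube a l = set0 by apply/seteqP; split => // x [Dx /h].
  by rewrite -setIA D0 setI0 !measure0 mule0.
have l20 : 0 < l / 2 by rewrite divr_gt0.
have stopc e : exists N, stop k (corner a l e) (l / 2) N.
  have [Ec|/ltW Ec] := leP (mu (E `&` dchild a l e)) (theta * mu (dchild a l e))%E.
    exact: IH.
  exists setT; split; rewrite ?setTI ?setIT//.
    apply: EG => //; rewrite muleCA -lebesgue_dchild//; apply: le_trans Ea.
    apply: subset_le_measure; last by apply: setIS; exact: dchild_sub.
      by apply: measurableI => //; exact: measurable_dcube.
    by apply: measurableI => //; exact: measurable_dcube.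
  by move=> D mD _; rewrite setDT setI0 set0I measure0 mule0.
have [N stopN] := choice stopc.
pose M := \bigcup_(e in [set: {ffun 'I_n -> bool}]) (N e `&` dchild a l e).
have MN e x : dchild a l e x -> (M x <-> N e x).
  move=> cx; split => [[e' _ [Nx c'x]]|Nx]; last by exists e.
  suff -> : e = e' by [].
  by apply: (trivIset_dchild l0 Logic.I Logic.I); exists x; split; [exact: cx|exact: c'x].
have mM : measurable M.
  apply: fin_bigcup_measurable; first exact: finite_finset.
  move=> e _; apply: measurableI; last exact: measurable_dcube.
  by have [] := stopN e.
have setM (h : set T -> set T) e :
    (forall X Y x, (X x <-> Y x) -> (h X x <-> h Y x)) ->
    h M `&` dchild a l e = h (N e) `&` dchild a l e.
  by move=> hh; apply/seteqP; split => x [hx cx]; split => //;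
    apply/(hh _ _ _ (MN _ _ cx)).
exists M; split => //.
- rewrite !measure_dchild//; last exact: measurableI.
  rewrite ge0_sume_distrr//; apply: lee_sum => e _.
  rewrite (setM id)// (setM (setI E)); last first.
    by move=> X Y x [? ?]; split => -[]; split; auto.
  by have [] := stopN e.
- rewrite !measure_dchild//; last exact: measurableI.
  rewrite ge0_sume_distrr//; apply: lee_sum => e _.
  rewrite (setM id)// (setM (setI G)); last first.
    by move=> X Y x [? ?]; split => -[]; split; auto.
  by have [] := stopN e.
- move=> D mD dD; rewrite !measure_dchild//; last 2 first.
  + exact: measurableD.
  + by apply: measurableI => //; exact: measurableD.
  rewrite ge0_sume_distrr//; apply: lee_sum => e _.
  rewrite (setM (setD D)); last by move=> X Y x [? ?]; split => -[]; split; auto.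
  rewrite (setM (fun X => E `&` (D `\` X))); last first.
    by move=> X Y x [? ?]; split => -[? []]; split; [|split| |split]; auto.
  by have [_ _ _] := stopN e; apply => //; exact: dD.
Qed.

(** Choose a dyadic [D] close to [E] and the stopped set [N] of the same
    generation.  The part of [D] outside [N] is nearly contained in [E] but
    filled by [E] only to the fraction [theta <= 1/2], so it is small; hence so
    is the part of [E] outside [N], also for [nu]. *)
Lemma stopping_decay (beta : \bar R) a l : 0 < l ->
  (forall e : R, 0 < e -> exists d : R, 0 < d /\
    forall A, A `<=` dcube a l -> measurable A ->
    (mu A <= d%:E)%E -> (nu A <= e%:E)%E) ->
  (theta <= (2^-1)%:E)%E ->
  (mu (E `&` dcube a l) <= (2^-1)%:E * (theta * mu (dcube a l)))%E ->
  (forall A, A `<=` dcube a l -> measurable A ->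
    (theta * mu A <= mu (E `&` dcube a l))%E -> (nu A <= beta)%E) ->
  G `<=` E ->
  (nu (G `&` dcube a l) <= kappa * beta)%E.
Proof.
move=> l0 ac theta2 Ea nub GE.
have mP := measurable_dcube a l.
have muP : mu (dcube a l) \is a fin_num by rewrite lebesgue_dcube.
have Ea' : (mu (E `&` dcube a l) <= theta * mu (dcube a l))%E.
  apply: le_trans Ea _; apply: gee_pMl; last by rewrite lee_fin invf_le1// ler1n.
    by [].
  by rewrite mule_ge0.
apply/lee_addgt0Pr => e /ac [d [d0 nud]].
have d30 : 0 < d / 3 by rewrite divr_gt0.
have [k [D [mD dD ED]]] := dapprox_measurable a l0 mE d30.
have [N [mN NE GN hN]] := calderon_zygmund k l0 Ea'.
have {}hN := hN _ mD dD.
set P := dcube a l in GN NE hN ED muP mP *.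
have mEN : measurable ((E `&` P) `\` N) by apply: measurableD => //; exact: measurableI.
have muEN : (mu ((E `&` P) `\` N) <= d%:E)%E.
  (* mu X <= mu X / 2 + d / 3, so mu X <= 2 d / 3 *)
  set X := (D `\` N) `&` P.
  have mX : measurable X by apply: measurableI => //; exact: measurableD.
  have X1 : (mu X <= mu (E `&` (D `\` N) `&` P) + (d / 3)%:E)%E.
    apply: le_trans (leeD (lexx _) ED); apply: le_trans (measureU2 _ _ _).
    - apply: subset_le_measure => //.
      + apply: measurableU; apply: measurableI => //.
        * by apply: measurableI => //; exact: measurableD.
        * by apply: measurableU; exact: measurableD.
      + move=> x [[Dx Nx] xP]; have [Ex|Ex] := pselect (E x); [left|right]; split => //.
        by right.
    - by apply: measurableI => //; apply: measurableI => //; exact: measurableD.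
    - by apply: measurableI => //; apply: measurableU; exact: measurableD.
  have Xfin : mu X \is a fin_num.
    rewrite ge0_fin_numE//; apply: le_lt_trans (_ : mu P < +oo)%E.
      by apply: subset_le_measure => // x [].
    by rewrite -ge0_fin_numE.
  have X2 : (mu X <= (2^-1)%:E * mu X + (d / 3)%:E)%E.
    apply: le_trans X1 _; rewrite leeD2r//; apply: le_trans hN _.
    exact: lee_wpmul2r.
  have X3 : (mu X <= (d / 3 * 2)%:E)%E.
    move: X2; rewrite -(fineK Xfin) -EFinM -EFinD !lee_fin => X2; lra.
  apply: le_trans (_ : (d / 3)%:E + (d / 3 * 2)%:E <= _)%E; last first.
    by rewrite -EFinD lee_fin; lra.
  apply: le_trans (leeD ED X3); apply: le_trans (measureU2 _ _ _) => //.
    apply: subset_le_measure => //.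
      apply: measurableU => //; apply: measurableI => //.
      by apply: measurableU; exact: measurableD.
    move=> x [[Ex xP] nN]; have [Dx|Dx] := pselect (D x); [right|left]; split => //.
    by left.
  by apply: measurableI => //; apply: measurableU; exact: measurableD.
apply: le_trans (_ : nu (G `&` N `&` P) + nu ((E `&` P) `\` N) <= _)%E.
  apply: le_trans (measureU2 _ _ _) => //.
    apply: subset_le_measure => //.
    - exact: measurableI.
    - by apply: measurableU => //; do 2 apply: measurableI => //.
    - move=> x [Gx xP]; have [Nx|Nx] := pselect (N x); [left|right]; split => //.
      by split => //; exact: GE.
  by do 2 apply: measurableI => //.
apply: leeD; last by apply: nud => //; move=> x [[]].
apply: le_trans GN _; apply: lee_wpmul2l => //.
apply: nub.
- by move=> x [].
- exact: measurableI.
- apply: le_trans NE _; apply: subset_le_measure.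
  + by do 2 apply: measurableI => //.
  + exact: measurableI.
  + by move=> x [[]].
Qed.

End stopping.

(** * The modulus of a complex number *)

Local Notation normc := ComplexField.Normc.normc.

Section complex_modulus.
Context {R : realType}.
Implicit Types x y z : R[i].

Lemma normcE x : normc x = Num.sqrt (complex.Re x ^+ 2 + complex.Im x ^+ 2).
Proof. by case: x. Qed.

Lemma normc_ge0 x : 0 <= normc x.
Proof. by rewrite normcE sqrtr_ge0. Qed.

Lemma normc_distC x y : normc (x - y) = normc (y - x).
Proof. by rewrite -[LHS]normcN opprB. Qed.

Lemma ler_normc_dist z x y : normc (x - y) <= normc (x - z) + normc (z - y).
Proof. by apply: le_trans (le_normcD _ _); rewrite addrA subrK. Qed.

Lemma ler_normc_Re x : `|complex.Re x| <= normc x.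
Proof. by rewrite normcE -sqrtr_sqr ler_wsqrtr// lerDl sqr_ge0. Qed.

Lemma ler_normc_Im x : `|complex.Im x| <= normc x.
Proof. by rewrite normcE -sqrtr_sqr ler_wsqrtr// lerDr sqr_ge0. Qed.

Lemma ler_normc_ReIm x : normc x <= `|complex.Re x| + `|complex.Im x|.
Proof.
rewrite normcE -[leRHS]ger0_norm ?addr_ge0// -sqrtr_sqr ler_wsqrtr//.
rewrite sqrrD !real_normK ?num_real// lerD2r lerDl.
by rewrite mulrn_wge0// mulr_ge0.
Qed.

End complex_modulus.

(** * Measures with a density *)

Section density_measure.
Context d (T : measurableType d) (R : realType) (m : {measure set T -> \bar R}).
Variables (u : T -> R) (mfu : measurable_fun setT u) (u0 : forall x, 0 <= u x).

(** The proofs of measurability and nonnegativity are arguments so that the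
    measure structure can be attached to the constant. *)
Definition density_measure of measurable_fun setT u & (forall x, 0 <= u x) :=
  fun A : set T => (\int[m]_(x in A) (u x)%:E)%E.

Local Notation nu := (density_measure mfu u0).

Let nu0 : nu set0 = 0%E.
Proof. by rewrite /density_measure integral_set0. Qed.

Let nu_ge0 A : (0 <= nu A)%E.
Proof. by apply: integral_ge0 => x _; rewrite lee_fin. Qed.

Let nu_sigma_additive : semi_sigma_additive nu.
Proof.
move=> F mF tF mUF; rewrite /density_measure ge0_integral_bigcup//.
- by apply: is_cvg_nneseries => i _ _; exact: nu_ge0.
- by apply/measurable_EFinP; exact: measurable_funTS.
- by move=> x _; rewrite lee_fin.
Qed.

HB.instance Definition _ := isMeasure.Build _ _ _ nu nu0 nu_ge0 nu_sigma_additive.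

Lemma density_measure_abs_cont (P : set T) : measurable P -> (nu P < +oo)%E ->
  forall e : R, 0 < e -> exists d : R, 0 < d /\
    forall A, A `<=` P -> measurable A -> (m A <= d%:E)%E -> (nu A <= e%:E)%E.
Proof.
move=> mP nuP e e0.
have mEu A : measurable_fun A (EFin \o u).
  by apply/measurable_EFinP; exact: measurable_funTS.
have intu : m.-integrable [set: T] (EFin \o (u \_ P)).
  rewrite -restrict_EFin; apply: (integrable_mkcond _ mP).1.
  apply/integrableP; split => //; apply: le_lt_trans nuP.
  by rewrite le_eqVlt; apply/orP; left; apply/eqP/eq_integral => x _;
    rewrite /= ger0_norm.
have [d0 [d00 h]] := integral_normr_continuous intu e0.
exists (d0 / 2); split; first by rewrite divr_gt0.
move=> A AP mA mAd; have {h} := h A mA.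
rewrite (le_lt_trans mAd) ?lte_fin ?ltr_pdivrMr// ?ltr_pMr// ?ltr1n//.
move=> /(_ isT)/ltW; rewrite /Rintegral -lee_fin.
have -> : (\int[m]_(x in A) `|(u \_ P) x|%:E = nu A)%E.
  apply: eq_integral => x; rewrite inE => /AP Px.
  by rewrite /= patchE mem_set// ger0_norm.
rewrite fineK// ge0_fin_numE//; apply: le_lt_trans nuP.
exact: subset_le_measure.
Qed.

Lemma density_measure_null A : measurable A -> m A = 0%E -> nu A = 0%E.
Proof.
move=> mA A0; apply: null_set_integral => //.
exact/measurable_EFinP/measurable_funTS.
Qed.

End density_measure.

(** * Exponential decay of the oscillation *)

Section john_nirenberg.
Context {R : realType} {n : nat}.
Local Notation T := (Rn R n).
Local Notation mu := (@lebesgue R n).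
Implicit Types (a : 'I_n -> R) (l : R).

Lemma measurable_normc_dist (f : T -> R[i]) (c : R[i]) : cmeasurable f ->
  measurable_fun setT (fun x => normc (f x - c)).
Proof.
move=> [mRe mIm].
rewrite (_ : (fun _ => _) = Num.sqrt \o (fun x =>
    (complex.Re (f x) - complex.Re c) ^+ 2 +
    (complex.Im (f x) - complex.Im c) ^+ 2)); last first.
  by apply/funext => x; rewrite normcE /=; case: (f x) c => ? ? [].
apply: measurableT_comp.
  by apply: continuous_measurable_fun; exact: sqrt_continuous.
by apply: measurable_funD; apply: measurable_funX; exact: measurable_funB.
Qed.

Lemma measurable_osc_gt (f : T -> R[i]) (c : R[i]) (t : R) : cmeasurable f ->
  measurable [set x | t < normc (f x - c)].
Proof.
move=> /(measurable_normc_dist c) mf.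
have := mf measurableT _ (measurable_itv `]t, +oo[).
rewrite setTI; congr measurable; apply/seteqP; split => x /=;
  by rewrite in_itv/= andbT.
Qed.

Variables (nu : {measure set T -> \bar R}) (beta : R).
Hypothesis beta0 : 0 <= beta.
Hypothesis nu_ac : forall a l, 0 < l -> forall e : R, 0 < e ->
  exists d : R, 0 < d /\ forall A, A `<=` dcube a l -> measurable A ->
    (mu A <= d%:E)%E -> (nu A <= e%:E)%E.
Hypothesis nu_half : forall a l A, 0 < l -> A `<=` dcube a l -> measurable A ->
  (mu A <= (2^-1)%:E * mu (dcube a l))%E -> (nu A <= beta%:E * nu (dcube a l))%E.

Variables (f : T -> R[i]) (c : ('I_n -> R) -> R -> R[i]) (s : R).
Hypotheses (mf : cmeasurable f) (s0 : 0 < s).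
Hypothesis osc_small : forall a l, 0 < l ->
  (mu ([set x | (s < normc (f x - c a l))%R] `&` dcube a l) <=
   ((2 ^+ n.+2)^-1)%:E * mu (dcube a l))%E.

(** One generation of stopping cubes costs a factor [beta] in mass and [2 s] in the
    centre: in a stopped cube the two sets where [f] is far from the two centres
    do not exhaust the cube, and a point outside both compares the centres. *)
Lemma osc_decay k a l : 0 < l ->
  (nu ([set x | ((k.*2.+1)%:R * s < normc (f x - c a l))%R] `&` dcube a l) <=
   (beta ^+ k)%:E * nu (dcube a l))%E.
Proof.
elim: k a l => [|k IH] a l l0.
  rewrite expr0 mul1e; apply: measureIr; [exact: measurable_osc_gt|].
  exact: measurable_dcube.
have nE : (2 ^+ n.+2 : R)^-1 = 2^-1 * (2 ^+ n.+1)^-1 by rewrite exprS invfM.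
have theta2 : (2 ^+ n.+1)^-1 <= (2^-1 : R).
  by rewrite lef_pV2 ?posrE ?exprn_gt0// exprS ler_peMr// exprn_ege1// ler1n.
rewrite exprSr EFinM -muleA.
apply: (@stopping_decay _ _ [set x | s < normc (f x - c a l)] _ nu
  ((2 ^+ n.+1)^-1)%:E (beta ^+ k)%:E) => //.
- exact: measurable_osc_gt.
- exact: measurable_osc_gt.
- by rewrite lee_fin exprn_ge0.
- move=> a' l' l'0; set P := dcube a' l' => EP.
  have [y [yP [y1 y2]]] : exists y, P y /\
      (normc (f y - c a l) <= s /\ normc (f y - c a' l') <= s).
    apply: contrapT => /forallNP h.
    have : (mu P <= mu ([set x | (s < normc (f x - c a l))%R] `&` P) +
                    mu ([set x | (s < normc (f x - c a' l'))%R] `&` P))%E.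
      have mP : measurable P by exact: measurable_dcube.
      apply: le_trans (measureU2 _ _ _); last 2 first.
      - by apply: measurableI => //; exact: measurable_osc_gt.
      - by apply: measurableI => //; exact: measurable_osc_gt.
      apply: subset_le_measure => //.
        by apply: measurableU; apply: measurableI => //; exact: measurable_osc_gt.
      move=> x xP; have [x1|x1] := ltP s (normc (f x - c a l)); first by left.
      have [x2|x2] := ltP s (normc (f x - c a' l')); first by right.
      by exfalso; apply: (h x).
    move=> /le_trans/(_ (leeD EP (osc_small a' l'0))).
    rewrite nE [mu P]lebesgue_dcube// muleA -!EFinM -EFinD lee_fin.
    have V0 : 0 < l' ^+ n by rewrite exprn_gt0.
    have -> : 2 ^+ n * (2 ^+ n.+1)^-1 = 2^-1 :> R.
      by rewrite exprS invfM mulrCA mulfV ?mulr1// expf_neq0// pnatr_eq0.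
    move: theta2.
    by move=> h1; rewrite -mulrDl -[leLHS]mul1r ler_pM2r// => h2; lra.
  apply: le_trans (IH a' l' l'0); apply: subset_le_measure.
  + by apply: measurableI; [exact: measurable_osc_gt|exact: measurable_dcube].
  + by apply: measurableI; [exact: measurable_osc_gt|exact: measurable_dcube].
  + apply: setSI => x /=.
    have := ler_normc_dist (c a' l') (f x) (c a l).
    have := ler_normc_dist (f y) (c a' l') (c a l).
    rewrite (normc_distC (c a' l') (f y)) doubleS -[k.*2.+3]addn2 natrD; lra.
- exact: nu_ac.
- by have := osc_small a l0; rewrite nE EFinM -muleA.
- move=> A AP mA hA; apply: nu_half => //.
  have := le_trans hA (osc_small a l0).
  rewrite lee_pdivrMl ?exprn_gt0// muleA -EFinM nE mulrCA mulfV ?mulr1//.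
- move=> x /=; apply: le_lt_trans; rewrite ler_peMl ?(ltW s0)// ler1n.
  exact: ltn0Sn.
Qed.

End john_nirenberg.

(** * From decay to integral bounds *)

(** For [c = ln q / 2], use [y <= exp y] at [y = x c / r] and raise to the power
    [r]; then [exp (x c)] is a multiple of [q ^ k] when [x = 2k+1]. *)
Lemma powR_odd_le_geometric (R : realType) (r q : R) : 0 < r -> 1 < q ->
  exists M : R, 0 < M /\ forall k : nat, (k.*2.+1)%:R `^ r <= M * q ^+ k.
Proof.
move=> r0 q1; pose c := ln q / 2.
have c0 : 0 < c by rewrite divr_gt0// ln_gt0.
have rc0 : 0 < r / c by rewrite divr_gt0.
exists ((r / c) `^ r * expR c); split => [|k].
  by rewrite mulr_gt0 ?powR_gt0 ?expR_gt0.
set x : R := (k.*2.+1)%:R.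
have x0 : 0 <= x by [].
have xE : x <= r / c * expR (x * c / r).
  rewrite -ler_pdivrMl// invf_div mulrC mulrA.
  by apply: le_trans (expR_ge1Dx _); rewrite lerDr.
apply: (@le_trans _ _ ((r / c * expR (x * c / r)) `^ r)).
  by apply: (ge0_ler_powR (ltW r0)); rewrite // nnegrE mulr_ge0 ?expR_ge0// ltW.
rewrite powRM ?expR_ge0//; last exact: ltW.
rewrite -[leRHS]mulrA ler_wpM2l ?powR_ge0// -expRM divfK ?gt_eqF//.
rewrite /x -addn1 natrD mulrDl mul1r addrC expRD ler_wpM2l ?expR_ge0//.
rewrite -muln2 natrM -mulrA /c [2%:R * _]mulrC divfK ?pnatr_eq0// expRM_natl.
by rewrite lnK// posrE (lt_trans _ q1).
Qed.

Section integral_of_decay.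
Context d (T : measurableType d) (R : realType) (m : {measure set T -> \bar R}).

(** Bound [g^r] by a sum over the levels [(2k+1) s]; the powers of the levels grow
    more slowly than the geometric rate [beta^(-1/2)], so the sum is dominated by
    a geometric series of ratio [sqrt beta]. *)
Lemma decay_integral (r beta : R) : 0 < r -> 2^-1 <= beta < 1 ->
  exists C : R, 0 < C /\ forall (u g : T -> R) (s : R) (Q : set T),
    measurable_fun setT u -> (forall x, 0 <= u x) ->
    measurable_fun setT g -> (forall x, 0 <= g x) ->
    0 < s -> measurable Q ->
    (forall k, (\int[m]_(x in [set x | ((k.*2.+1)%:R * s < g x)%R] `&` Q) (u x)%:E
       <= (beta ^+ k)%:E * \int[m]_(x in Q) (u x)%:E)%E) ->
    (\int[m]_(x in Q) (g x `^ r * u x)%:E <=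
       (C * s `^ r)%:E * \int[m]_(x in Q) (u x)%:E)%E.
Proof.
move=> r0 /andP[b2 b1].
have b0 : 0 < beta by rewrite (lt_le_trans _ b2).
pose q := Num.sqrt beta.
have q0 : 0 < q by rewrite sqrtr_gt0.
have qq : q ^+ 2 = beta by rewrite sqr_sqrtr// ltW.
have q1 : q < 1 by rewrite -(@ltr_pXn2r _ 2)// ?nnegrE ?ltW// qq expr1n.
have [M [M0 hM]] := powR_odd_le_geometric r0 (ltac:(by rewrite invf_gt1) : 1 < q^-1).
exists (2 * M / (1 - q)); split.
  by rewrite divr_gt0 ?subr_gt0// mulr_gt0.
move=> u g s Q mfu u0 mg g0 s0 mQ hE.
(* adding s on the right makes E 0 the whole space and, for positive k,
   E k the set where g exceeds (2k-1)s *)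
pose E k := [set x | k.*2%:R * s < g x + s].
have mE k : measurable (E k).
  have mgs : measurable_fun setT (fun x => g x + s) by exact: measurable_funD.
  have := mgs measurableT _ (measurable_itv `]k.*2%:R * s, +oo[).
  by rewrite setTI; congr measurable; apply/seteqP; split => x /=;
    rewrite in_itv/= andbT.
set I := (\int[m]_(x in Q) (u x)%:E)%E.
have I0 : (0 <= I)%E by apply: integral_ge0 => x _; rewrite lee_fin.
have hEk k : (\int[m]_(x in Q `&` E k) (u x)%:E <= (2 * beta ^+ k)%:E * I)%E.
  case: k => [|k].
    rewrite expr0 mulr1 (_ : Q `&` E 0%N = Q); last first.
      apply/seteqP; split => [x []//|x Qx]; split => //.
      by rewrite /E/= mul0r ltr_wpDl.
    by rewrite -[leLHS]mul1e lee_wpmul2r// lee_fin ler1n.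
  apply: le_trans (_ : (beta ^+ k)%:E * I <= _)%E; last first.
    rewrite lee_wpmul2r// lee_fin exprS mulrA ler_peMl ?exprn_ge0 ?(ltW b0)//; lra.
  rewrite (_ : Q `&` E k.+1 = [set x | ((k.*2.+1)%:R * s < g x)%R] `&` Q)//.
  rewrite setIC; congr setI; apply/seteqP; split => x; rewrite /E/= doubleS;
    by rewrite -[k.*2.+2]addn1 natrD mulrDl mul1r ltrD2r.
pose a k : R := ((k.*2.+1)%:R * s) `^ r.
pose h k x := ((a k)%:E * ((fun x => (u x)%:E) \_ (E k)) x)%E.
have meu D : measurable_fun D (fun x => (u x)%:E).
  by apply/measurable_EFinP; exact: measurable_funTS.
have muE k : measurable_fun Q ((fun x => (u x)%:E) \_ (E k)).
  by apply/measurable_restrict.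
have uE0 k x : (0 <= ((fun x => (u x)%:E) \_ (E k)) x)%E.
  by rewrite patchE; case: ifP => // _; rewrite lee_fin.
have h0 k x : (0 <= h k x)%E by rewrite mule_ge0// lee_fin powR_ge0.
have mh k : measurable_fun Q (h k) by apply: measurable_funeM.
apply: (@le_trans _ _ (\int[m]_(x in Q) (\sum_(k <oo) h k x))%E).
  apply: ge0_le_integral => //.
  - by move=> x _; rewrite lee_fin mulr_ge0 ?powR_ge0.
  - apply/measurable_EFinP; apply: measurable_funM; last exact: measurable_funTS.
    apply: (measurableT_comp (measurable_powR r)); exact: measurable_funTS.
  - exact: ge0_emeasurable_sum.
  move=> x Qx.
  have exK : exists K, g x <= K.*2.+1%:R * s.
    exists (Num.truncn (g x / s)); rewrite -ler_pdivrMr//.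
    apply: le_trans (ltW (truncnS_gt _)) _.
    by rewrite ler_nat ltnS -addnn leq_addl.
  have EK : E (ex_minn exK) x.
    case: ex_minnP => -[|K] gK minK; first by rewrite /E/= mul0r ltr_wpDl.
    rewrite /E/= ltNge; apply/negP => gsK.
    suff : (K.+1 <= K)%N by rewrite ltnn.
    by apply: minK; move: gsK; rewrite doubleS -[K.*2.+2]addn1 natrD mulrDl mul1r
      lerD2r.
  case: ex_minnP EK => K gK _ EK.
  apply: le_trans (nneseries_lim_ge K.+1 (fun k _ _ => h0 k x)).
  rewrite big_nat_recr//=; apply: le_trans (_ : h K x <= _)%E; last first.
    by rewrite leeDr// sume_ge0.
  rewrite /h patchE mem_set// -EFinM lee_fin ler_wpM2r//.
  apply: (ge0_ler_powR (ltW r0)) => //; rewrite nnegrE//.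
  by rewrite mulr_ge0// ltW.
rewrite integral_nneseries//.
apply: lime_le; first by apply: is_cvg_nneseries => k _ _; exact: integral_ge0.
apply: nearW => N.
have hk k : (\int[m]_(x in Q) h k x <= (2 * M * s `^ r * q ^+ k)%:E * I)%E.
  rewrite ge0_integralZl_EFin//; last exact: powR_ge0.
  rewrite -integral_mkcondr.
  apply: le_trans (lee_wpmul2l _ (hEk k)) _; first by rewrite lee_fin powR_ge0.
  rewrite muleA -EFinM lee_wpmul2r// lee_fin /a powRM//; last exact: ltW.
  apply: (@le_trans _ _ ((M * q^-1 ^+ k) * s `^ r * (2 * beta ^+ k))).
    by rewrite ler_wpM2r ?mulr_ge0 ?exprn_ge0 ?(ltW b0)// ler_wpM2r ?powR_ge0.
  rewrite le_eqVlt; apply/orP; left; apply/eqP.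
  rewrite -qq -exprM mulnC exprM expr2 exprVn.
  by have := expf_neq0 k (lt0r_neq0 q0) => ?; field.
apply: le_trans (lee_sum _ (fun k _ => hk k)) _.
rewrite -ge0_sume_distrl; last first.
  by move=> k _; rewrite lee_fin !mulr_ge0 ?powR_ge0 ?exprn_ge0 ?(ltW M0)// ltW.
apply: lee_wpmul2r => //; rewrite sumEFin lee_fin -mulr_sumr big_mkord.
have SN : \sum_(i < N) q ^+ i <= (1 - q)^-1.
  rewrite -[leRHS]div1r ler_pdivlMr ?subr_gt0//.
  have := subrX1 q N; have := exprn_ge0 N (ltW q0); lra.
rewrite [leRHS](_ : _ = 2 * M * s `^ r * (1 - q)^-1); last by rewrite mulrAC.
by rewrite ler_wpM2l// !mulr_ge0 ?powR_ge0// ltW.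
Qed.

End integral_of_decay.

(** * Weights of A_infty *)

Lemma measurable_powRNy (R : realType) (s : R) :
  measurable_fun setT (fun y : R => powRNy y s).
Proof.
apply: measurable_fun_ifT; first exact: measurable_fun_eqr.
  exact: measurable_cst.
by apply/measurable_EFinP; exact: measurable_powR.
Qed.

Lemma integral0_null d (T : measurableType d) (R : realType)
    (m : {measure set T -> \bar R}) (w : T -> R) (D : set T) :
  measurable_fun setT w -> (forall x, 0 <= w x) -> measurable D ->
  (\int[m]_(x in D) (w x)%:E = 0)%E ->
  m (D `&` [set x | w x != 0]) = 0%E /\
  measurable (D `&` [set x | w x != 0]).
Proof.
move=> mw w0 mD I0.
have mN : measurable (D `&` [set x | w x != 0]).
  apply: measurableI => //.
  have := mw measurableT (~` [set 0]) (measurableC (measurable_set1 _)).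
  by rewrite setTI; congr measurable; apply/seteqP; split => x /= /eqP.
split => //; apply: measure_negligible => //.
have : (\int[m]_(x in D) `|(w x)%:E| = 0)%E.
  by rewrite -I0; apply: eq_integral => x _; rewrite gee0_abs// lee_fin.
have mEw : measurable_fun D (EFin \o w).
  by apply/measurable_EFinP; exact: measurable_funTS.
move/(ae_eq_integral_abs m mD mEw).
apply: negligibleS => x [Dx /eqP wx] /= h; apply: wx.
by have := h Dx => -[].
Qed.

Section nonneg_integrals.
Context d (T : measurableType d) (R : realType) (m : {measure set T -> \bar R}).
Local Open Scope ereal_scope.

Lemma subset_integral_ge0T (A B : set T) (f : T -> \bar R) :
  measurable A -> measurable B -> measurable_fun setT f -> (forall x, 0 <= f x) ->
  A `<=` B -> \int[m]_(x in A) f x <= \int[m]_(x in B) f x.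
Proof.
move=> mA mB mf f0; apply: ge0_subset_integral => //; exact: measurable_funTS.
Qed.

Lemma le_integral_ge0T (D : set T) (f g : T -> \bar R) :
  measurable D -> measurable_fun setT f -> measurable_fun setT g ->
  (forall x, 0 <= f x) -> (forall x, D x -> f x <= g x) ->
  \int[m]_(x in D) f x <= \int[m]_(x in D) g x.
Proof.
move=> mD mf mg f0 fg; apply: ge0_le_integral => //; exact: measurable_funTS.
Qed.

End nonneg_integrals.

Section regular_weights.
Context {R : realType} {n : nat}.
Local Notation T := (Rn R n).
Local Notation mu := (@lebesgue R n).
Implicit Types (a : 'I_n -> R) (l : R) (u w : T -> R) (Q : set T).

(** The quantitative absolute continuity of Lebesgue measure with respect to the
    weight: this is all that the argument takes from A_infty, and the weight 1
    has it too. *)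
Definition regular_weight u : Prop :=
  [/\ measurable_fun setT u, (forall x, 0 <= u x),
      (forall Q, cubes Q -> (0 < \int[mu]_(x in Q) (u x)%:E < +oo)%E) &
      forall alpha : R, 0 < alpha -> exists delta : R, 0 < delta /\
        forall Q E, cubes Q -> measurable E -> E `<=` Q ->
          (alpha%:E * mu Q <= mu E)%E ->
          (delta%:E * \int[mu]_(x in Q) (u x)%:E <=
           \int[mu]_(x in E) (u x)%:E)%E].

Lemma measurable_cube Q : cubes Q -> measurable Q.
Proof. by move=> [a [l [l0 ->]]]; exact/(@measurable_closed_cube _ _ a)/ltW. Qed.

Lemma lebesgue_cube Q : cubes Q -> 0 < vol Q /\ mu Q = (vol Q)%:E.
Proof.
move=> [a [l [l0 ->]]]; rewrite /vol (@lebesgue_closed_cube _ _ a l (ltW l0)).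
by rewrite /= exprn_gt0.
Qed.

Let meu u : measurable_fun setT u -> forall D : set T,
  measurable_fun D (fun x => (u x)%:E).
Proof. by move=> mfu D; apply/measurable_EFinP; exact: measurable_funTS. Qed.

Lemma regular_weight1 : regular_weight (cst 1).
Proof.
have I1 (A : set T) : measurable A -> (\int[mu]_(x in A) (cst (1 : R) x)%:E = mu A)%E.
  by move=> mA; rewrite (@integral_cst _ _ _ mu A mA 1%E) mul1e.
split => // [Q cQ|alpha alpha0].
  rewrite I1; last exact: measurable_cube.
  by have [V0 ->] := lebesgue_cube cQ; rewrite lte_fin V0 ltry.
exists alpha; split => // Q E cQ mE EQ; rewrite !I1//; exact: measurable_cube.
Qed.

Lemma powRNy_ge0 (x s : R) : (0 <= powRNy x s)%E.
Proof. by rewrite /powRNy; case: ifP => // _; rewrite lee_fin powR_ge0. Qed.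

Section Ap_weight.
Variables (p : R) (w : T -> R).
Hypotheses (p1 : 1 < p) (hw : Ap p w).

Let r := conj_exp p / p.
Let t := p / conj_exp p.

Let tE : t = p - 1.
Proof.
by rewrite /t /conj_exp invf_div mulrCA mulfV ?mulr1// gt_eqF// (lt_trans _ p1).
Qed.

Let rE : r = t^-1. Proof. by rewrite /r /t invf_div. Qed.

Let t0 : 0 < t. Proof. by rewrite tE subr_gt0. Qed.

Let wavg Q := (((vol Q)^-1)%:E * \int[mu]_(x in Q) (w x)%:E)%E.
Let savg Q := (((vol Q)^-1)%:E * \int[mu]_(x in Q) powRNy (w x) r)%E.

Lemma Ap_bound : exists M : R, 0 < M /\ forall Q, cubes Q ->
  (wavg Q * savg Q `^ t <= M%:E)%E.
Proof.
have [_ _ _ _] := hw; set S := ereal_sup _ => Soo.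
exists (Num.max 1 (fine S)); split => [|Q cQ]; first by rewrite lt_max ltr01.
have : (wavg Q * savg Q `^ t <= S)%E by apply: ereal_sup_ubound; exists Q.
move=> /le_trans; apply; case: S Soo => [x|//|] _; last by rewrite leNye.
by rewrite lee_fin le_max lexx orbT.
Qed.

Let mw : measurable_fun setT w. Proof. by have [] := hw. Qed.
Let w0 x : 0 <= w x. Proof. by have [] := hw. Qed.
Let mpow : measurable_fun setT (fun x => powRNy (w x) r).
Proof. exact: (measurableT_comp (measurable_powRNy r)). Qed.
Let I0 A : (0 <= \int[mu]_(x in A) (w x)%:E)%E.
Proof. by apply: integral_ge0 => x _; rewrite lee_fin. Qed.

Let savg_lty Q : cubes Q -> (0 < wavg Q)%E -> (savg Q < +oo)%E.
Proof.
move=> cQ W0; have [M [M0 /(_ _ cQ)]] := Ap_bound.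
rewrite ltNge leye_eq; apply: contraTN => /eqP /(eqy_poweR t0) ->.
by rewrite gt0_muley// -ltNge ltry.
Qed.

(** A positive average over the larger cube would make the dual average finite,
    but it is infinite, as [w] vanishes on [Q]. *)
Let zero_cube Q : cubes Q -> ((\int[mu]_(x in Q) (w x)%:E) = 0)%E ->
  forall Q', cubes Q' -> Q `<=` Q' -> ((\int[mu]_(x in Q') (w x)%:E) = 0)%E.
Proof.
move=> cQ wQ Q' cQ' QQ'; apply/eqP; rewrite eq_le I0 andbT leNgt; apply/negP => wQ'.
have [V0 muQ] := lebesgue_cube cQ; have [V'0 _] := lebesgue_cube cQ'.
have mQ := measurable_cube cQ; have mQ' := measurable_cube cQ'.
have : (savg Q' < +oo)%E.
  by apply: savg_lty => //; rewrite mule_gt0// lte_fin invr_gt0.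
have [N0 mN] := integral0_null mw w0 mQ wQ.
pose Z := Q `\` (Q `&` [set x | w x != 0]).
have mZ : measurable Z by exact: measurableD.
suff -> : savg Q' = +oo%E by [].
rewrite /savg (_ : (\int[mu]_(x in Q') powRNy (w x) r)%E = +oo%E).
  by rewrite gt0_muley// lte_fin invr_gt0.
apply/eqP; rewrite -leye_eq.
have -> : +oo%E = (\int[mu]_(x in Z) cst +oo x)%E.
  rewrite integral_cst// [X in (_ * X)%E](_ : mu Z = (vol Q)%:E) ?gt0_mulye//.
  have := measureDI mu mQ mN; rewrite -/Z (setIidr (@subIsetl _ _ _)).
  by rewrite [X in (_ + X)%E]N0 adde0 => <-.
apply: (@le_trans _ _ (\int[mu]_(x in Z) powRNy (w x) r)%E).
  apply: (le_integral_ge0T mu mZ (measurable_cst _) mpow).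
    by move=> x; rewrite leey.
  move=> x [Qx nx]; rewrite /powRNy; case: eqP => // /eqP wx.
  by exfalso; apply: nx.
apply: (subset_integral_ge0T mu mZ mQ' mpow); first by move=> x; exact: powRNy_ge0.
by move=> x [/QQ'].
Qed.

(** If [w] vanished on a cube, the dual average over any larger cube would be
    infinite, and the A_p bound would force [w] to vanish there as well, hence
    almost everywhere. *)
Lemma Ap_weight_gt0 Q : cubes Q -> (0 < \int[mu]_(x in Q) (w x)%:E)%E.
Proof.
move=> cQ; rewrite lt0e I0 andbT; apply/eqP => wQ.
have [_ _ _ + _] := hw; apply.
have [a [l [l0 QE]]] := cQ.
pose Qk k := closed_cube (fun i => a i - k%:R) (l + k%:R *+ 2) : set T.
have cQk k : cubes (Qk k).
  exists (fun i => a i - k%:R), (l + k%:R *+ 2); split => //.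
  by rewrite ltr_pwDl// mulrn_wge0.
have QQk k : Q `<=` Qk k.
  rewrite QE => x xQ i; have /andP[h1 h2] := xQ i.
  by have k0 : 0 <= k%:R :> R by []; apply/andP; split; rewrite ?mulr2n; lra.
have /= wQk k := integral0_null mw w0 (measurable_cube (cQk k))
  (zero_cube cQ wQ (cQk k) (@QQk k)).
change (mu.-negligible (~` [set x | w x = 0])).
have nU : mu.-negligible (\bigcup_k (Qk k `&` [set x | w x != 0])).
  by apply: negligible_bigcup => k; have [? ?] := wQk k; exact/negligibleP.
apply: negligibleS nU => x /= wx.
pose y i : R := tnth x i - a i.
have [k hk] : exists k : nat, forall i : 'I_n, `|y i| <= k%:R :> R.
  exists (\max_(i < n) (Num.truncn `|y i|).+1) => i.
  apply: le_trans (ltW (truncnS_gt _)) _; rewrite ler_nat.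
  exact: (@leq_bigmax _ (fun i => (Num.truncn `|y i|).+1)).
exists k => //; split; last by apply/eqP.
move=> i; have := hk i; rewrite /y ler_norml => /andP[h1 h2].
by apply/andP; split; rewrite ?mulr2n; lra.
Qed.

(** With [t = p - 1], the A_p bound controls the dual average by the average of [w],
    so by Chebyshev's inequality [w] is at least a fixed multiple [tau] of its
    average outside a set of relative measure [alpha / 2]; a set of relative
    measure [alpha] keeps at least half of its measure outside that set. *)
Lemma Ap_regular_weight : regular_weight w.
Proof.
have [M [M0 hM]] := Ap_bound.
split => // [Q cQ|alpha alpha0].
  by rewrite Ap_weight_gt0//=; have [_ _ + _ _] := hw; apply.
pose b := alpha / 2; have b0 : 0 < b by rewrite divr_gt0.
exists (b `^ t / M * b); split; first by rewrite mulr_gt0// divr_gt0// powR_gt0.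
move=> Q E cQ mE EQ aE.
have [V0 muQ] := lebesgue_cube cQ; have mQ := measurable_cube cQ.
have wQ0 := Ap_weight_gt0 cQ.
have wQfin : (\int[mu]_(x in Q) (w x)%:E)%E \is a fin_num.
  by rewrite ge0_fin_numE//; have [_ _ + _ _] := hw; apply.
have W0 : (0 < wavg Q)%E by rewrite mule_gt0// lte_fin invr_gt0.
have Sfin : savg Q \is a fin_num.
  rewrite ge0_fin_numE ?savg_lty//.
  rewrite mule_ge0 ?lee_fin ?invr_ge0 ?(ltW V0)//.
  by apply: integral_ge0 => x _; exact: powRNy_ge0.
have := hM Q cQ.
pose W := fine (\int[mu]_(x in Q) (w x)%:E)%E.
have WE : (\int[mu]_(x in Q) (w x)%:E)%E = W%:E by rewrite fineK.
pose S := fine (savg Q).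
have SE : savg Q = S%:E by rewrite fineK.
have Wp : 0 < W by rewrite -lte_fin -WE.
rewrite SE poweR_EFin /wavg WE -!EFinM lee_fin => WS.
have S0 : 0 <= S.
  rewrite -lee_fin -SE mule_ge0 ?lee_fin ?invr_ge0 ?(ltW V0)//.
  by apply: integral_ge0 => x _; exact: powRNy_ge0.
pose tau := b `^ t / M * ((vol Q)^-1 * W).
have tau0 : 0 < tau.
  by rewrite mulr_gt0 ?divr_gt0 ?powR_gt0// mulr_gt0 ?invr_gt0.
pose X := Q `&` [set x | w x < tau].
have mX : measurable X.
  apply: measurableI => //.
  have := mw measurableT (measurable_itv `]-oo, tau[).
  by rewrite setTI; congr measurable; apply/seteqP; split => x /=; rewrite in_itv.
have muX : (mu X <= (b * vol Q)%:E)%E.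
  have hX : ((tau `^ (- r))%:E * mu X <= (S * vol Q)%:E)%E.
    rewrite -integral_cst//.
    apply: (@le_trans _ _ (\int[mu]_(x in X) powRNy (w x) r)%E).
      apply: (le_integral_ge0T mu mX (measurable_cst _) mpow).
        by move=> x; rewrite lee_fin powR_ge0.
      move=> x [_ /= xt]; rewrite /powRNy; case: eqP => [_|/eqP wx].
        by rewrite leey.
      have wx0 : 0 < w x by rewrite lt_neqAle eq_sym wx w0.
      rewrite lee_fin !powRN lef_pV2 ?posrE ?powR_gt0//.
      by apply: ge0_ler_powR; rewrite ?nnegrE ?ltW// rE invr_gt0.
    have -> : (S * vol Q)%:E = (\int[mu]_(x in Q) powRNy (w x) r)%E.
      rewrite EFinM -SE /savg muleAC -EFinM mulVf ?mul1e//; exact: lt0r_neq0.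
    apply: (subset_integral_ge0T mu mX mQ mpow); first by move=> x; exact: powRNy_ge0.
    by move=> x [].
  have tauS : tau `^ r * S <= b.
    have -> : S = (S `^ t) `^ r.
      by rewrite -powRrM rE mulfV ?powRr1//; exact: lt0r_neq0.
    rewrite -powRM ?powR_ge0 ?(ltW tau0)//.
    have -> : b = (b `^ t) `^ r.
      by rewrite -powRrM rE mulfV ?powRr1 ?(ltW b0)//; exact: lt0r_neq0.
    apply: ge0_ler_powR; rewrite ?nnegrE ?powR_ge0//.
    - by rewrite rE invr_ge0 ltW.
    - by rewrite mulr_ge0 ?powR_ge0// ltW.
    rewrite /tau -mulrA -[leRHS]mulr1 -mulrA ler_wpM2l ?powR_ge0//.
    by rewrite mulrC ler_pdivrMr// mul1r.
  move: hX; rewrite powRN lee_pdivrMl ?powR_gt0// => /le_trans; apply.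
  by rewrite -EFinM lee_fin mulrA ler_wpM2r// ltW.
have muEX : ((b * vol Q)%:E <= mu (E `\` X))%E.
  have mEX : measurable (E `&` X) by exact: measurableI.
  have := measureDI mu mE mX => muE.
  have : (mu E <= mu (E `\` X) + (b * vol Q)%:E)%E.
    rewrite muE leeD2l// (le_trans _ muX)//.
    by apply: subset_le_measure => // x [].
  move=> /(le_trans aE); rewrite muQ -leeBlDr//.
  rewrite -EFinM -EFinB (_ : alpha * vol Q - b * vol Q = b * vol Q)//.
  rewrite /b; lra.
have mEX : measurable (E `\` X) by exact: measurableD.
have mEw : measurable_fun setT (fun x => (w x)%:E) by exact/measurable_EFinP.
apply: (@le_trans _ _ (tau%:E * mu (E `\` X))%E).
  apply: le_trans (lee_wpmul2l _ muEX); last by rewrite lee_fin ltW.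
  rewrite -EFinM lee_fin /tau le_eqVlt; apply/orP; left; apply/eqP.
  by have := lt0r_neq0 V0 => ?; have := lt0r_neq0 M0 => ?; field; apply/andP.
rewrite -integral_cst//.
apply: (@le_trans _ _ (\int[mu]_(x in E `\` X) (w x)%:E)%E).
  apply: (le_integral_ge0T mu mEX (measurable_cst _) mEw).
  - by move=> x; rewrite lee_fin ltW.
  - move=> x [/EQ Qx nX]; rewrite lee_fin leNgt; apply/negP => xt.
    by apply: nX.
apply: (subset_integral_ge0T mu mEX mE mEw); first by move=> x; rewrite lee_fin.
by move=> x [].
Qed.

End Ap_weight.

Lemma Ainfty_regular_weight w : Ainfty w -> regular_weight w.
Proof. by move=> [p p1 hw]; exact: Ap_regular_weight p1 hw. Qed.

End regular_weights.

(** * Oscillation and weighted means *)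

Section weighted_mean.
Context d (T : measurableType d) (R : realType) (m : {measure set T -> \bar R}).

Lemma markov_density (u h : T -> R) (t : R) (D : set T) :
  measurable_fun setT u -> (forall x, 0 <= u x) ->
  measurable_fun setT h -> (forall x, 0 <= h x) -> 0 <= t -> measurable D ->
  (t%:E * \int[m]_(x in [set x | (t < h x)%R] `&` D) (u x)%:E <=
   \int[m]_(x in D) (h x * u x)%:E)%E.
Proof.
move=> mfu u0 mh h0 t0 mD.
have mE : measurable ([set x | (t < h x)%R] `&` D).
  apply: measurableI => //.
  have := mh measurableT _ (measurable_itv `]t, +oo[).
  by rewrite setTI; congr measurable; apply/seteqP; split => x /=;
    rewrite in_itv/= andbT.
rewrite -ge0_integralZl_EFin//; last first.
- by apply/measurable_EFinP; exact: measurable_funTS.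
- by move=> x _; rewrite lee_fin.
have mhu : measurable_fun setT (fun x => (h x * u x)%:E).
  by apply/measurable_EFinP; exact: measurable_funM.
apply: (@le_trans _ _ (\int[m]_(x in [set x | (t < h x)%R] `&` D) (h x * u x)%:E)%E).
  apply: (le_integral_ge0T m mE) => //.
  - by apply/measurable_EFinP; exact: measurable_funM.
  - by move=> x; rewrite -EFinM lee_fin mulr_ge0.
  - by move=> x [/ltW tx _]; rewrite -EFinM lee_fin ler_wpM2r.
apply: (subset_integral_ge0T m mE mD mhu).
  by move=> x; rewrite lee_fin mulr_ge0.
by move=> x [].
Qed.

(** The difference is the weighted mean of [h - k]. *)
Lemma weighted_mean_dist (u h g : T -> R) (k K : R) (D : set T) :
  measurable_fun setT u -> (forall x, 0 <= u x) ->
  measurable_fun setT h -> measurable_fun setT g ->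
  (forall x, `|h x - k| <= g x) -> measurable D ->
  (0 < \int[m]_(x in D) (u x)%:E < +oo)%E ->
  (\int[m]_(x in D) (g x * u x)%:E <= K%:E * \int[m]_(x in D) (u x)%:E)%E ->
  `|(\int[m]_(x in D) u x)^-1 * \int[m]_(x in D) (h x * u x) - k| <= K.
Proof.
move=> mfu u0 mh mg hg mD /andP[W0 Woo] gK.
set W := \int[m]_(x in D) u x.
have WE : (\int[m]_(x in D) (u x)%:E)%E = W%:E.
  by rewrite /W /Rintegral fineK// ge0_fin_numE// ltW.
have g0 x : 0 <= g x by exact: le_trans (hg x).
have mf (f : T -> R) : measurable_fun setT f -> measurable_fun D (EFin \o f).
  by move=> ?; apply/measurable_EFinP; exact: measurable_funTS.
have iu : m.-integrable D (EFin \o u).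
  apply/integrableP; split; first exact: mf.
  rewrite (eq_integral (fun x => (u x)%:E))// => x _.
  by rewrite /= ger0_norm.
have mgu : measurable_fun setT (fun x => g x * u x) by exact: measurable_funM.
have igu : m.-integrable D (EFin \o (fun x => g x * u x)).
  apply/integrableP; split; first exact: mf.
  rewrite (eq_integral (fun x => (g x * u x)%:E)); last first.
    by move=> x _; rewrite /= ger0_norm ?mulr_ge0.
  apply: le_lt_trans gK _.
  by rewrite WE -EFinM ltry.
have mhku : measurable_fun setT (fun x => (h x - k) * u x).
  by apply: measurable_funM => //; exact: measurable_funB.
have ihku : m.-integrable D (EFin \o (fun x => (h x - k) * u x)).
  apply: le_integrable igu => //; first exact: mf.
  by move=> x _; rewrite /= lee_fin normrM [leRHS]ger0_norm ?mulr_ge0//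
    (ger0_norm (u0 x)) ler_wpM2r.
have iku : m.-integrable D (EFin \o (fun x => k * u x)).
  by have := integrableZl mD k iu; apply: eq_integrable => // x _; rewrite /= EFinM.
have -> : \int[m]_(x in D) (h x * u x) =
    \int[m]_(x in D) ((h x - k) * u x) + k * W.
  rewrite -RintegralZl// -RintegralD//; apply: eq_Rintegral => x _.
  by rewrite -mulrDl subrK.
have {}W0 : 0 < W by rewrite -lte_fin -WE.
rewrite mulrDr [_ * (k * W)]mulrCA mulVf ?mulr1 ?addrK; last exact: lt0r_neq0.
rewrite normrM ger0_norm ?invr_ge0 ?(ltW W0)// mulrC ler_pdivrMr//.
apply: (le_trans (le_normr_Rintegral mD ihku)).
apply: (@le_trans _ _ (\int[m]_(x in D) (g x * u x))).
  apply: le_Rintegral => //.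
  - have := integrable_abse ihku; apply: eq_integrable => // x _.
  - by move=> x Dx; rewrite normrM (ger0_norm (u0 x)) ler_wpM2r.
rewrite -lee_fin EFinM -WE; apply: le_trans (gK).
rewrite /Rintegral fineK// ge0_fin_numE; last first.
  by apply: integral_ge0 => x _; rewrite lee_fin mulr_ge0.
apply: le_lt_trans gK _.
by rewrite WE -EFinM ltry.
Qed.

End weighted_mean.

Section oscillation.
Context {R : realType} {n : nat}.
Local Notation T := (Rn R n).
Local Notation mu := (@lebesgue R n).
Implicit Types (a : 'I_n -> R) (l : R) (u v w : T -> R) (Q : set T)
  (f : T -> R[i]) (c : set T -> R[i]).

(** If [A] fills at most half of a cube, its complement carries at least a fixed
    fraction of the mass. *)
Lemma regular_weight_half u (mfu : measurable_fun setT u) (u0 : forall x, 0 <= u x) :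
  regular_weight u -> exists beta : R, 2^-1 <= beta < 1 /\
  forall a l (A : set T), 0 < l -> A `<=` dcube a l -> measurable A ->
    (mu A <= (2^-1)%:E * mu (dcube a l))%E ->
    (density_measure mu mfu u0 A <= beta%:E * density_measure mu mfu u0 (dcube a l))%E.
Proof.
move=> [_ _ uQ thick]; set nu := density_measure mu mfu u0.
have h0 : 0 < 2^-1 :> R by rewrite invr_gt0.
have [delta [delta0 hdelta]] := thick _ h0.
pose d' := Num.min delta 2^-1.
have d'0 : 0 < d' by rewrite lt_min delta0.
have d'2 : d' <= 2^-1 by rewrite ge_min lexx orbT.
have d'd : d' <= delta by rewrite ge_min lexx.
exists (1 - d'); split; first by apply/andP; split; lra.
move=> a l A l0 AP mA muA.
set P := dcube a l in AP muA *.
pose Q := closed_cube a l.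
have cQ : cubes Q by exists a, l.
have mQ : measurable Q := measurable_cube cQ.
have mP : measurable P := measurable_dcube a l.
have PQ : P `<=` Q := @dcube_sub_closed _ _ a l.
have mQP : measurable (Q `\` P) by exact: measurableD.
have N0 : mu (Q `\` P) = 0%E := lebesgue_closed_cubeD a l0.
have nuN0 : nu (Q `\` P) = 0%E by exact: density_measure_null.
have muQP : mu Q = mu P.
  have := measureDI mu mQ mP; rewrite (setIidr PQ).
  by rewrite [X in (X + _)%E]N0 add0e.
have nuQP : nu Q = nu P.
  have := measureDI nu mQ mP; rewrite (setIidr PQ).
  by rewrite [X in (X + _)%E]nuN0 add0e.
have AQ : A `<=` Q by exact: subset_trans PQ.
have mQA : measurable (Q `\` A) by exact: measurableD.
have /andP[_ nuQoo] := uQ _ cQ.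
have nuQfin : nu Q \is a fin_num by rewrite ge0_fin_numE.
have [V0 muQ] := lebesgue_cube cQ.
have nuE : (d'%:E * nu Q <= nu (Q `\` A))%E.
  apply: le_trans (_ : delta%:E * nu Q <= _)%E.
    by apply: lee_wpmul2r => //; rewrite lee_fin.
  apply: hdelta => //.
  have muD : (mu Q = mu (Q `\` A) + mu A)%E.
    by rewrite [LHS](measureDI mu mQ mA) (setIidr AQ).
  have Afin : mu A \is a fin_num.
    rewrite ge0_fin_numE//; apply: le_lt_trans (_ : mu Q < +oo)%E.
      exact: subset_le_measure.
    by rewrite muQ ltry.
  have Dfin : mu (Q `\` A) \is a fin_num.
    rewrite ge0_fin_numE//; apply: le_lt_trans (_ : mu Q < +oo)%E.
      by apply: subset_le_measure => // x [].
    by rewrite muQ ltry.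
  move: muD muA; rewrite -muQP muQ -(fineK Afin) -(fineK Dfin).
  by rewrite -!EFinM -EFinD !lee_fin => -[] muD muA; lra.
have nuD : (nu Q = nu (Q `\` A) + nu A)%E.
  by rewrite [LHS](measureDI nu mQ mA) (setIidr AQ).
have nuAfin : nu A \is a fin_num.
  rewrite ge0_fin_numE//; apply: le_lt_trans nuQoo; exact: subset_le_measure.
have nuDfin : nu (Q `\` A) \is a fin_num.
  rewrite ge0_fin_numE//; apply: le_lt_trans nuQoo.
  by apply: subset_le_measure => // x [].
move: nuD nuE; rewrite -nuQP -(fineK nuAfin) -(fineK nuDfin) -(fineK nuQfin).
by rewrite -!EFinM -EFinD !lee_fin => -[] nuD nuE; lra.
Qed.

(** The fraction [2^-(n+2)] is half the stopping threshold [2^-(n+1)], so the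
    stopped cubes fill at most half of the cube. *)
Definition osc_small f c (s : R) := forall Q, cubes Q ->
  (mu ([set x | (s < normc (f x - c Q))%R] `&` Q) <=
   ((2 ^+ n.+2)^-1)%:E * mu Q)%E.

Lemma osc_small_recenter f c c' (s t : R) : cmeasurable f -> osc_small f c s ->
  (forall Q, cubes Q -> normc (c' Q - c Q) <= t) -> osc_small f c' (s + t).
Proof.
move=> mf fc cc' Q cQ; apply: le_trans (fc Q cQ).
have mQ := measurable_cube cQ.
apply: subset_le_measure.
- by apply: measurableI => //; exact: measurable_osc_gt.
- by apply: measurableI => //; exact: measurable_osc_gt.
- apply: setSI => x /=; have := ler_normc_dist (c Q) (f x) (c' Q).
  by rewrite (normc_distC (c Q)); have := cc' Q cQ; lra.
Qed.

Lemma osc_small_integral u (r : R) : regular_weight u -> 0 < r ->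
  exists C : R, 0 < C /\ forall f c (s : R), cmeasurable f -> 0 < s ->
    osc_small f c s -> forall Q, cubes Q ->
    (\int[mu]_(x in Q) (normc (f x - c Q) `^ r * u x)%:E <=
     (C * s `^ r)%:E * \int[mu]_(x in Q) (u x)%:E)%E.
Proof.
move=> ru r0; have [mfu u0 uQ _] := ru.
have [beta [b12 hbeta]] := regular_weight_half mfu u0 ru.
have [b2 b1] := andP b12.
have b0 : 0 <= beta by rewrite (le_trans _ b2).
have [C [C0 hC]] := decay_integral mu r0 b12.
exists C; split => // f c s mf s0 fc Q cQ.
set nu := density_measure mu mfu u0 in hbeta.
have g0 x : 0 <= normc (f x - c Q) by exact: normc_ge0.
apply: (hC u _ s Q mfu u0 (measurable_normc_dist (c Q) mf) g0 s0 (measurable_cube cQ)).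
move=> k; have [a [l [l0 QE]]] := cQ.
have QE' : Q = closed_cube a l by [].
have mP : measurable (dcube a l) := measurable_dcube a l.
have mQ := measurable_cube cQ.
have PQ : dcube a l `<=` Q by rewrite QE'; exact: dcube_sub_closed.
have mQP : measurable (Q `\` dcube a l) by exact: measurableD.
have nuN0 : nu (Q `\` dcube a l) = 0%E.
  by apply: density_measure_null => //; rewrite QE'; exact: lebesgue_closed_cubeD.
have nuI (A : set T) : measurable A -> nu (A `&` Q) = nu (A `&` dcube a l).
  move=> mA; have mAQ : measurable (A `&` Q) by exact: measurableI.
  have : (nu (A `&` Q) = nu ((A `&` Q) `\` dcube a l) + nu ((A `&` Q) `&` dcube a l))%E.
    by rewrite [LHS](measureDI nu mAQ mP).
  rewrite -setIA (setIidr PQ) => ->.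
  suff -> : nu ((A `&` Q) `\` dcube a l) = 0%E by rewrite add0e.
  apply: (@subset_measure0 _ _ _ nu _ (Q `\` dcube a l)) => //.
    exact: measurableD.
  by move=> x [[]].
have nuQP : nu Q = nu (dcube a l) by have := nuI setT measurableT; rewrite !setTI.
have mS := measurable_osc_gt (c Q) ((k.*2.+1)%:R * s) mf.
suff od : (nu ([set x | ((k.*2.+1)%:R * s < normc (f x - c Q))%R] `&` dcube a l) <=
    (beta ^+ k)%:E * nu (dcube a l))%E by rewrite -nuI// -nuQP in od.
rewrite QE'.
apply: (@osc_decay _ _ nu beta b0 _ hbeta f
  (fun a l => c (closed_cube a l)) s mf s0 _ k a l l0).
- move=> a' l' l'0; apply: density_measure_abs_cont; first exact: measurable_dcube.
  have cQ' : cubes (closed_cube a' l') by exists a', l'.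
  have /andP[_ ] := uQ _ cQ'.
  apply: le_lt_trans; apply: (@subset_le_measure _ _ _ nu).
  + exact: measurable_dcube.
  + exact/measurable_closed_cube/ltW.
  + exact: dcube_sub_closed.
- move=> a' l' l'0.
  have cQ' : cubes (closed_cube a' l') by exists a', l'.
  have := fc _ cQ'.
  have -> : mu (closed_cube a' l') = mu (dcube a' l').
    by rewrite lebesgue_closed_cube ?ltW// lebesgue_dcube.
  apply: le_trans; apply: subset_le_measure.
  + by apply: measurableI; [exact: measurable_osc_gt|exact: measurable_dcube].
  + by apply: measurableI; [exact: measurable_osc_gt|exact: measurable_cube].
  + by apply: setIS; exact: dcube_sub_closed.
Qed.

End oscillation.

Lemma Re_scaleB (R : realType) (k a b : R) (z : R[i]) :
  complex.Re (k%:C%C * Complex a b - z) = k * a - complex.Re z.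
Proof. by case: z => z1 z2 /=; rewrite mul0r subr0. Qed.

Lemma Im_scaleB (R : realType) (k a b : R) (z : R[i]) :
  complex.Im (k%:C%C * Complex a b - z) = k * b - complex.Im z.
Proof. by case: z => z1 z2 /=; rewrite mul0r addr0. Qed.

Section bmo.
Context {R : realType} {n : nat}.
Local Notation T := (Rn R n).
Local Notation mu := (@lebesgue R n).
Implicit Types (u v w : T -> R) (Q : set T) (f : T -> R[i]) (c : set T -> R[i]).

(** The real and imaginary parts are estimated separately, each within [K]. *)
Lemma wmean_dist v f (z : R[i]) (K : R) Q : regular_weight v -> cmeasurable f ->
  cubes Q ->
  (\int[mu]_(x in Q) (normc (f x - z) * v x)%:E <=
     K%:E * \int[mu]_(x in Q) (v x)%:E)%E ->
  normc (wmean v f Q - z) <= K + K.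
Proof.
move=> [mv v0 vQ _] mf cQ hK; have [mRe mIm] := mf.
have mQ := measurable_cube cQ.
have mg := measurable_normc_dist z mf.
have hRe x : `|complex.Re (f x) - complex.Re z| <= normc (f x - z).
  by apply: le_trans (ler_normc_Re _); case: (f x) (z) => ? ? [].
have hIm x : `|complex.Im (f x) - complex.Im z| <= normc (f x - z).
  by apply: le_trans (ler_normc_Im _); case: (f x) (z) => ? ? [].
have dRe := weighted_mean_dist mv v0 mRe mg hRe mQ (vQ _ cQ) hK.
have dIm := weighted_mean_dist mv v0 mIm mg hIm mQ (vQ _ cQ) hK.
apply: le_trans (ler_normc_ReIm _) _; apply: lerD.
- apply: le_trans dRe; rewrite le_eqVlt; apply/orP; left; apply/eqP.
  rewrite /wmean /cintegral /weight Re_scaleB; congr (`|_ * _ - _|).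
  by apply: eq_Rintegral => x _; case: (f x) => ? ? /=; rewrite mulr0 subr0.
- apply: le_trans dIm; rewrite le_eqVlt; apply/orP; left; apply/eqP.
  rewrite /wmean /cintegral /weight Im_scaleB; congr (`|_ * _ - _|).
  by apply: eq_Rintegral => x _; case: (f x) => ? ? /=; rewrite mulr0 add0r.
Qed.

Lemma weighted_integral_lty v f (z : R[i]) (K : R) Q :
  regular_weight v -> cmeasurable f -> cubes Q ->
  (\int[mu]_(x in Q) (normc (f x - z) * v x)%:E <=
     K%:E * \int[mu]_(x in Q) (v x)%:E)%E ->
  (\int[mu]_(x in Q) (normc (f x) * v x)%:E < +oo)%E.
Proof.
move=> [mv v0 vQ _] mf cQ hK; have mQ := measurable_cube cQ.
have /andP[W0 Woo] := vQ _ cQ.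
have Wfin : (\int[mu]_(x in Q) (v x)%:E)%E \is a fin_num.
  by rewrite ge0_fin_numE// ltW.
have mg := measurable_normc_dist z mf.
have mg0 : measurable_fun setT (fun x => normc (f x)).
  have := measurable_normc_dist 0 mf; congr measurable_fun.
  by apply/funext => x; rewrite subr0.
have mgv : measurable_fun setT (fun x => (normc (f x - z) * v x)%:E).
  by apply/measurable_EFinP; exact: measurable_funM.
have mzv : measurable_fun setT (fun x => ((normc z)%:E * (v x)%:E)%E).
  by apply: measurable_funeM; exact/measurable_EFinP.
have mfv : measurable_fun setT (fun x => (normc (f x) * v x)%:E).
  by apply/measurable_EFinP; exact: measurable_funM.
have msum : measurable_fun setT
    (fun x => ((normc (f x - z) * v x)%:E + (normc z)%:E * (v x)%:E)%E).
  exact: emeasurable_funD.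
apply: (@le_lt_trans _ _ (\int[mu]_(x in Q)
    ((normc (f x - z) * v x)%:E + (normc z)%:E * (v x)%:E))%E).
  apply: (le_integral_ge0T mu mQ mfv msum).
    by move=> x; rewrite lee_fin mulr_ge0// normc_ge0.
  move=> x _; rewrite -EFinM -EFinD lee_fin -mulrDl ler_wpM2r//.
  by rewrite -{1}(subrK z (f x)) le_normcD.
rewrite (ge0_integralD mu mQ); last 4 first.
- by move=> x _; rewrite lee_fin mulr_ge0// normc_ge0.
- exact: measurable_funTS.
- by move=> x _; rewrite -EFinM lee_fin mulr_ge0// normc_ge0.
- exact: measurable_funTS.
rewrite (ge0_integralZl_EFin mu mQ); last 3 first.
- by move=> x _; rewrite lee_fin.
- by apply: measurable_funTS; exact/measurable_EFinP.
- exact: normc_ge0.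
apply: le_lt_trans (leeD hK (lexx _)) _.
by rewrite -(fineK Wfin) -!EFinM -EFinD ltry.
Qed.

(** The centres [c Q] are within a multiple of [s] of the [v]-means, because the
    [v]-mean of [|f - c Q|] is bounded by a multiple of [s]. *)
Lemma osc_small_wmean v : regular_weight v -> exists D : R, 0 < D /\
  forall f c (s : R), cmeasurable f -> 0 < s -> osc_small f c s ->
  L1loc v f /\ osc_small f (wmean v f) (D * s).
Proof.
move=> rv; have [C [C0 hC]] := osc_small_integral rv ltr01.
exists (1 + (C + C)); split; first by rewrite addr_gt0// addr_gt0.
move=> f c s mf s0 fc.
have hQ Q : cubes Q -> (\int[mu]_(x in Q) (normc (f x - c Q) * v x)%:E <=
    (C * s)%:E * \int[mu]_(x in Q) (v x)%:E)%E.
  move=> cQ; have := hC f c s mf s0 fc Q cQ; rewrite powRr1 ?(ltW s0)//.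
  apply: le_trans; rewrite le_eqVlt; apply/orP; left; apply/eqP.
  by apply: eq_integral => x _; rewrite powRr1 ?normc_ge0.
split.
  split => // Q cQ; exact: (weighted_integral_lty rv mf cQ (hQ Q cQ)).
rewrite mulrDl mul1r mulrDl; apply: osc_small_recenter fc _ => // Q cQ.
exact: (wmean_dist rv mf cQ (hQ Q cQ)).
Qed.

Lemma mean_wmean f Q : cubes Q -> mean f Q = wmean (cst 1) f Q.
Proof.
move=> cQ; have mQ := measurable_cube cQ; rewrite /mean /wmean; congr (_^-1%:C%C * _).
  by rewrite /weight Rintegral_cst// mul1r.
rewrite /cintegral; congr Complex; apply: eq_Rintegral => x _;
  by case: (f x) => ? ? /=; rewrite !(mulr1, mulr0, subr0, addr0, add0r).
Qed.

Lemma integral_weight1 (g : T -> R) Q :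
  (\int[mu]_(x in Q) (g x * (cst 1 : T -> R) x)%:E = \int[mu]_(x in Q) (g x)%:E)%E.
Proof. by apply: eq_integral => x _; rewrite mulr1. Qed.

Lemma integral_cst1_cube Q : cubes Q ->
  (\int[mu]_(x in Q) ((cst 1 : T -> R) x)%:E = (vol Q)%:E)%E.
Proof.
move=> cQ; have mQ := measurable_cube cQ; have [_ <-] := lebesgue_cube cQ.
by rewrite (@integral_cst _ _ _ mu Q mQ 1%E) mul1e.
Qed.

Let thr : 0 < (2 ^+ n.+2)^-1 :> R. Proof. by rewrite invr_gt0 exprn_gt0. Qed.

Lemma BMO_osc_small f (s : R) : cmeasurable f -> 0 < s -> (BMO_norm f <= s%:E)%E ->
  osc_small f (mean f) (2 ^+ n.+2 * s).
Proof.
move=> mf s0 fs Q cQ.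
have mQ := measurable_cube cQ; have [V0 muQ] := lebesgue_cube cQ.
have t0 : 0 < 2 ^+ n.+2 * s by rewrite mulr_gt0// exprn_gt0.
have g0 x : 0 <= normc (f x - mean f Q) by exact: normc_ge0.
have := markov_density mu (measurable_cst (1 : R)) (fun=> ler01)
  (measurable_normc_dist (mean f Q) mf) g0 (ltW t0) mQ.
rewrite integral_weight1; set E := _ `&` Q.
have mE : measurable E by apply: measurableI => //; exact: measurable_osc_gt.
rewrite [X in (_ * X <= _)%E](_ : _ = mu E); last first.
  by rewrite (@integral_cst _ _ _ mu E mE 1%E) mul1e.
have : (((vol Q)^-1)%:E * \int[mu]_(x in Q) (normc (f x - mean f Q))%:E <= s%:E)%E.
  by apply: le_trans fs; apply: ereal_sup_ubound; exists Q.
rewrite lee_pdivrMl// => h1 h2; have := le_trans h2 h1.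
rewrite mulrC EFinM -muleA [leRHS]muleC lee_pmul2l ?lte_fin// => h3.
by rewrite lee_pdivlMl ?exprn_gt0// muQ.
Qed.

(** * The two inequalities *)

Lemma weighted_osc_le_BMO_norm (p : R) w v : 0 < p -> regular_weight w ->
  regular_weight v -> exists C : R, 0 < C /\ forall f (s : R), 0 < s ->
  cmeasurable f -> (BMO_norm f <= s%:E)%E ->
  L1loc v f /\ (weighted_osc p w v f <= (C * s)%:E)%E.
Proof.
move=> p0 rw rv; have [D [D0 hD]] := osc_small_wmean rv.
have [C [C0 hC]] := osc_small_integral rw p0.
pose B : R := D * 2 ^+ n.+2.
have B0 : 0 < B by rewrite mulr_gt0// exprn_gt0.
exists (C `^ p^-1 * B); split; first by rewrite mulr_gt0// powR_gt0.
move=> f s s0 mf fs; have t0 : 0 < 2 ^+ n.+2 * s by rewrite mulr_gt0// exprn_gt0.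
have [Lf fv] := hD f _ _ mf t0 (BMO_osc_small mf s0 fs).
split => //; apply: ge_ereal_sup => _ [Q cQ <-].
rewrite mulrA -/B in fv.
have Bs0 : 0 < B * s by rewrite mulr_gt0.
have := hC f _ _ mf Bs0 fv Q cQ; set I := (\int[mu]_(x in Q) _)%E => hI.
have [_ w0 wQ _] := rw; have /andP[W0 Woo] := wQ _ cQ.
have WE : (\int[mu]_(x in Q) (w x)%:E)%E = (weight w Q)%:E.
  by rewrite /weight /Rintegral fineK// ge0_fin_numE// ltW.
rewrite WE lte_fin in W0.
have I0 : (0 <= I)%E.
  by apply: integral_ge0 => x _; rewrite lee_fin mulr_ge0// powR_ge0.
have pV : C `^ p^-1 * B * s = (C * (B * s) `^ p) `^ p^-1.
  rewrite powRM ?powR_ge0 ?(ltW C0)// -powRrM mulfV ?lt0r_neq0//.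
  by rewrite powRr1 ?(ltW Bs0)// mulrA.
rewrite pV -poweR_EFin; apply: gt0_ler_poweR.
- by rewrite invr_ge0 ltW.
- by rewrite in_itv/= leey andbT mule_ge0// lee_fin invr_ge0 ltW.
- by rewrite in_itv/= leey andbT lee_fin mulr_ge0 ?powR_ge0// ltW.
by rewrite lee_pdivrMl// -EFinM mulrC EFinM -WE.
Qed.

(** The constant makes [(B s)^p delta = 2 s^p], so that on a large exceptional set
    the [w]-integral of [|f - f_{v,Q}|^p] would exceed its bound [s^p w(Q)]. *)
Lemma weighted_osc_osc_small (p : R) w v : 0 < p -> regular_weight w ->
  exists B : R, 0 < B /\ forall f (s : R), 0 < s -> cmeasurable f ->
  (weighted_osc p w v f <= s%:E)%E -> osc_small f (wmean v f) (B * s).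
Proof.
move=> p0 [mw w0 wQ thick]; have [delta [delta0 hdelta]] := thick _ thr.
exists ((2 / delta) `^ p^-1); split; first by rewrite powR_gt0// divr_gt0.
move=> f s s0 mf fs Q cQ; rewrite leNgt; apply/negP => big.
set B := (2 / delta) `^ p^-1 in big.
have B0 : 0 < B by rewrite powR_gt0// divr_gt0.
have Bs0 : 0 < B * s by rewrite mulr_gt0.
have mQ := measurable_cube cQ.
have /andP[W0 Woo] := wQ _ cQ.
have WE : (\int[mu]_(x in Q) (w x)%:E)%E = (weight w Q)%:E.
  by rewrite /weight /Rintegral fineK// ge0_fin_numE// ltW.
set E := _ `&` Q in big.
have mE : measurable E by apply: measurableI => //; exact: measurable_osc_gt.
have EQ : E `<=` Q by move=> x [].
have wE := hdelta Q E cQ mE EQ (ltW big).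
have mg := measurable_normc_dist (wmean v f Q) mf.
have mgp : measurable_fun setT (fun x => normc (f x - wmean v f Q) `^ p).
  exact: (measurableT_comp (measurable_powR p)).
have gp0 x : 0 <= normc (f x - wmean v f Q) `^ p by exact: powR_ge0.
have := markov_density mu mw w0 mgp gp0 (powR_ge0 (B * s) p) mQ.
rewrite [X in X `&` Q](_ : _ = [set x | B * s < normc (f x - wmean v f Q)]); last first.
  apply/seteqP; split => x /= h.
    rewrite ltNge; apply/negP => h'; move: h; rewrite ltNge => /negP; apply.
    by apply: (ge0_ler_powR (ltW p0)) => //; rewrite nnegrE ?normc_ge0// ltW.
  by apply: (gt0_ltr_powR p0) => //; rewrite nnegrE ?normc_ge0// ltW.
rewrite -/E; set I := (X in (_ <= X)%E) => hI.
have I0 : (0 <= I)%E.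
  by apply: integral_ge0 => x _; rewrite lee_fin mulr_ge0.
have W0' : 0 < weight w Q by rewrite -lte_fin -WE.
have Y0 : (0 <= ((weight w Q)^-1)%:E * I)%E.
  by rewrite mule_ge0// lee_fin invr_ge0 ltW.
have : ((((weight w Q)^-1)%:E * I) `^ p^-1 <= s%:E)%E.
  by apply: le_trans fs; apply: ereal_sup_ubound; exists Q.
move=> /(gt0_ler_poweR (ltW p0)); rewrite !in_itv/= !leey poweR_ge0 lee_fin ltW//.
move=> /(_ isT isT) /=; rewrite -poweRrM mulVf ?lt0r_neq0// poweRe1//.
rewrite lee_pdivrMl// => Is.
have := le_trans (lee_wpmul2l (_ : 0 <= ((B * s) `^ p)%:E)%E wE) (le_trans hI Is).
rewrite WE lee_fin powR_ge0 => /(_ isT).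
rewrite -!EFinM lee_fin powRM ?(ltW B0) ?(ltW s0)// /B -powRrM mulVf ?lt0r_neq0//.
rewrite powRr1 ?divr_ge0 ?(ltW delta0)//.
have -> : 2 / delta * s `^ p * (delta * weight w Q) = 2 * (weight w Q * s `^ p).
  by have := lt0r_neq0 delta0 => ?; field.
have : 0 < weight w Q * s `^ p by rewrite mulr_gt0// powR_gt0.
lra.
Qed.

Lemma BMO_norm_le_weighted_osc (p : R) w v : 0 < p -> regular_weight w ->
  exists C : R, 0 < C /\ forall f (s : R), 0 < s -> cmeasurable f ->
  (weighted_osc p w v f <= s%:E)%E ->
  L1loc (cst 1) f /\ (BMO_norm f <= (C * s)%:E)%E.
Proof.
move=> p0 rw; have [B [B0 hB]] := weighted_osc_osc_small v p0 rw.
have r1 : regular_weight (cst 1 : T -> R) := regular_weight1.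
have [D [D0 hD]] := osc_small_wmean r1.
have [C [C0 hC]] := osc_small_integral r1 ltr01.
exists (C * (D * B)); split; first by rewrite !mulr_gt0.
move=> f s s0 mf fs; have Bs0 : 0 < B * s by rewrite mulr_gt0.
have [Lf f1] := hD f _ _ mf Bs0 (hB f s s0 mf fs).
split => //; apply: ge_ereal_sup => _ [Q cQ <-].
have DBs0 : 0 < D * (B * s) by rewrite mulr_gt0.
have := hC f _ _ mf DBs0 f1 Q cQ.
rewrite integral_weight1 integral_cst1_cube// powRr1 ?(ltW DBs0)//.
have [V0 _] := lebesgue_cube cQ.
rewrite lee_pdivrMl// -[in X in (_ <= X)%E]EFinM mean_wmean// => h.
rewrite (eq_integral (fun x => (normc (f x - wmean (cst 1) f Q) `^ 1)%:E)).
  by apply: le_trans h _; rewrite -!EFinM lee_fin [leLHS]mulrC !mulrA.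
by move=> x _; rewrite powRr1 ?normc_ge0.
Qed.

Lemma cubes_neq0 : exists Q : set T, cubes Q.
Proof. by exists (closed_cube (fun=> 0) 1), (fun=> 0), 1. Qed.

Lemma BMO_norm_ge0 f : (0 <= BMO_norm f)%E.
Proof.
have [Q cQ] := cubes_neq0; have [V0 _] := lebesgue_cube cQ.
apply: le_trans (_ : _ <= ((vol Q)^-1)%:E *
    \int[mu]_(x in Q) (normc (f x - mean f Q))%:E)%E _; last first.
  by apply: ereal_sup_ubound; exists Q.
rewrite mule_ge0 ?lee_fin ?invr_ge0 ?(ltW V0)//.
by apply: integral_ge0 => x _; rewrite lee_fin normc_ge0.
Qed.

Lemma weighted_osc_ge0 (p : R) w v f : (0 <= weighted_osc p w v f)%E.
Proof.
have [Q cQ] := cubes_neq0.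
apply: le_trans (poweR_ge0 (((weight w Q)^-1)%:E *
    \int[mu]_(x in Q) (normc (f x - wmean v f Q) `^ p * w x)%:E) p^-1) _.
by apply: ereal_sup_ubound; exists Q.
Qed.

End bmo.

(** The previous bounds hold for positive real majorants [s] only; letting [s]
    decrease to [y] covers [y = 0]. *)
Lemma lee_scale_of_real_bounds (R : realType) (C : R) (x y : \bar R) : 0 < C ->
  (0 <= y < +oo)%E -> (forall s, 0 < s -> (y <= s%:E)%E -> (x <= (C * s)%:E)%E) ->
  (x <= C%:E * y)%E.
Proof.
move=> C0; case: y => [y| |]; [|by rewrite ltxx andbF|by []].
rewrite lee_fin => /andP[y0 _] h; apply/lee_addgt0Pr => e e0.
rewrite -EFinM -EFinD (_ : C * y + e = C * (y + e / C)); last first.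
  by rewrite mulrDr [C * (_ / _)]mulrC divfK// lt0r_neq0.
by apply: h; rewrite ?ltr_wpDl ?divr_gt0// lee_fin lerDl ltW// divr_gt0.
Qed.

Theorem theorem5p2 (R : realType) (n : nat) (hn : (0 < n)%N) (p : R)
  (hp : 0 < p) (w v : Rn R n -> R) (hw : Ainfty w) (hv : Ainfty v) :
  (forall f : Rn R n -> R[i],
      L1loc v f /\ (weighted_osc p w v f < +oo)%E <-> BMO f) /\
  exists C : R, 0 < C /\
    forall f : Rn R n -> R[i], BMO f ->
      (BMO_norm f <= C%:E * weighted_osc p w v f)%E /\
      (weighted_osc p w v f <= C%:E * BMO_norm f)%E.
Proof.
have rw := Ainfty_regular_weight hw; have rv := Ainfty_regular_weight hv.
have [A [A0 hA]] := weighted_osc_le_BMO_norm hp rw rv.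
have [B [B0 hB]] := BMO_norm_le_weighted_osc v hp rw.
have realb (y : \bar R) : (0 <= y)%E -> (y < +oo)%E ->
    exists2 s : R, 0 < s & (y <= s%:E)%E.
  case: y => [y| |]//; rewrite lee_fin => y0 _; exists (y + 1).
    by rewrite ltr_wpDl.
  by rewrite lee_fin lerDl.
have toosc f : BMO f -> L1loc v f /\ (weighted_osc p w v f < +oo)%E.
  move=> [[mf _] fBMO]; have [s s0 fs] := realb _ (BMO_norm_ge0 f) fBMO.
  have [Lf fosc] := hA f s s0 mf fs; split => //.
  by apply: le_lt_trans fosc _; rewrite ltry.
split => [f|].
  split => [[[mf _] fosc]|]; last exact: toosc.
  have [s s0 fs] := realb _ (weighted_osc_ge0 p w v f) fosc.
  have [Lf fbmo] := hB f s s0 mf fs; split => //.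
  by apply: le_lt_trans fbmo _; rewrite ltry.
exists (Num.max A B); split; first by rewrite lt_max A0.
move=> f fBMO; have [[mf _] fosc] := toosc f fBMO; have [_ fbmo] := fBMO.
split.
- apply: (@le_trans _ _ (B%:E * weighted_osc p w v f)%E).
    apply: lee_scale_of_real_bounds; rewrite ?weighted_osc_ge0// => s s0 fs.
    by have [] := hB f s s0 mf fs.
  by apply: lee_wpmul2r; rewrite ?weighted_osc_ge0// lee_fin le_max lexx orbT.
- apply: (@le_trans _ _ (A%:E * BMO_norm f)%E).
    apply: lee_scale_of_real_bounds; rewrite ?BMO_norm_ge0// => s s0 fs.
    by have [] := hA f s s0 mf fs.
  by apply: lee_wpmul2r; rewrite ?BMO_norm_ge0// lee_fin le_max lexx.
Qed.
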